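(* Let $(X,\|\cdot\|_X)$ be a reflexive real Banach space and $(Y,\langle\cdot,\cdot\rangle_Y)$ a real Hilbert space. Let $I,\psi:X\to\mathbf{R}$ be two $C^1$ functionals with $I(0)=\psi(0)=0$ and $\sup_X\psi>0$, and let $\varphi:X\to Y$ be a $C^1$ operator with $\varphi(0)=0$. Assume that $I$ is weakly lower semicontinuous and coercive, and that $I'$ admits a continuous inverse on $X^*$. Moreover, assume that the operators $\varphi'$ and $\psi'$ are compact and that $$\lim_{\|x\|_X\to+\infty}\frac{\langle\varphi(x),y\rangle_Y}{I(x)}=0$$ for all $y$ in a convex and dense set $T\subseteq Y$. Set $$\theta^*:=\inf_{x\in\psi^{-1}(]0,+\infty[)}\frac{I(x)}{\psi(x)},$$ $$\tilde\theta:=\begin{cases}\displaystyle\liminf_{x\in\psi^{-1}(]0,+\infty[),\ \|x\|_X\to+\infty}\frac{I(x)}{\psi(x)} & \text{if } \psi^{-1}(]0,+\infty[)\text{ is unbounded},\\ +\infty & \text{otherwise,}\end{cases}$$ and assume that $\theta^*<\tilde\theta$. Then, for each $\lambda\in\,]\theta^*,\tilde\theta[$ with $\lambda\ge 0$, either the equation $$I'(x)=-\partial_x\langle\varphi(x),\varphi(x)\rangle_Y+\lambda\psi'(x)$$ has a non-zero solution $x\in X$, or, for each convex set $S\subseteq T$ dense in $Y$, there exists $\tilde y\in S$ such that the equation $$I'(x)=\partial_x\langle\varphi(x),\tilde y\rangle_Y+\lambda\psi'(x)$$ has at least three solutions in $X$, two of which are global minima in $X$ of the functional $$x\mapsto I(x)-\langle\varphi(x),\tilde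 y\rangle_Y-\lambda\psi(x).$$
   Context: $]a,b[$ denotes the open interval. For each fixed $y\in Y$, $\partial_x\langle\varphi(\cdot),y\rangle_Y:X\to X^*$ denotes the derivative of the functional $x\mapsto\langle\varphi(x),y\rangle_Y$; thus $\partial_x\langle\varphi(x),y\rangle_Y(u)=\langle\varphi'(x)(u),y\rangle_Y$ for all $x,u\in X$. In particular, $\partial_x\langle\varphi(x),\varphi(x)\rangle_Y$ means this derivative evaluated at $x$ with the second argument frozen at $y=\varphi(x)$, i.e. it is the element of $X^*$ given by $u\mapsto\langle\varphi'(x)(u),\varphi(x)\rangle_Y$ (it is not the derivative of $x\mapsto\|\varphi(x)\|_Y^2$). $I$ is coercive if $\lim_{\|x\|_X\to+\infty}I(x)=+\infty$. $I'$ admits a continuous inverse on $X^*$ if there exists a continuous operator $R:X^*\to X$ such that $R(I'(x))=x$ for all $x\in X$. The operators $\varphi':X\to\mathcal{L}(X,Y)$ and $\psi':X\to X^*$ are compact in the sense that they are continuous and map bounded sets to relatively compact sets, where $\mathcal{L}(X,Y)$ (bounded linear operators) carries the operator norm. *)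

(* Defs.v *)
From HB Require Import structures.
From mathcomp Require Import all_boot all_order all_algebra.
From mathcomp Require Import all_classical all_reals all_analysis.
From mathcomp Require Import sesquilinear.

Set Implicit Arguments.
Unset Strict Implicit.
Unset Printing Implicit Defensive.

Import Order.TTheory GRing.Theory Num.Theory.
Import numFieldNormedType.Exports.

Local Open Scope classical_set_scope.
Local Open Scope ring_scope.

Reserved Notation "{ 'bounded' X -> Y }"
  (at level 0, X at level 98, Y at level 99,
   format "{ 'bounded'  X  ->  Y }").

Section BoundedOperators.
Context {R : realType}.
Variables X Y : normedModType R.

(* For linear maps between normed spaces, continuity is boundedness
   ([linear_bounded_continuous]). *)
Definition bounded_linear : {pred X -> Y} :=
  mem [set f : X -> Y | linear f /\ continuous f].

Record bounded_op := BoundedOp {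
  bounded_op_fun :> X -> Y ;
  _ : bounded_op_fun \in bounded_linear }.

HB.instance Definition _ := [isSub for bounded_op_fun].
HB.instance Definition _ := [Choice of bounded_op by <:].

Lemma bounded_linear_submod_closed : submod_closed bounded_linear.
Proof.
split.
  rewrite inE; split=> [a u v|x]; last exact: cvg_cst.
  by rewrite -[LHS]/(0 : Y) -[RHS]/(a *: 0 + 0) scaler0 addr0.
move=> a f g; rewrite !inE => -[lf cf] [lg cg]; split=> [b u v|x].
  rewrite -[LHS]/(a *: f (b *: u + v) + g (b *: u + v)) lf lg.
  rewrite -[RHS]/(b *: (a *: f u + g u) + (a *: f v + g v)).
  by rewrite !scalerDr !scalerA (mulrC a b) addrACA.
by apply: cvgD; [apply: cvgZr; exact: cf|exact: cg].
Qed.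

HB.instance Definition _ :=
  GRing.isSubmodClosed.Build _ _ bounded_linear bounded_linear_submod_closed.
HB.instance Definition _ := [SubChoice_isSubLmodule of bounded_op by <:].

End BoundedOperators.

Notation "{ 'bounded' X -> Y }" := (bounded_op X Y) : type_scope.

Section BoundedOperatorTheory.
Context {R : realType} {X Y : normedModType R}.
Implicit Types f g : {bounded X -> Y}.

Lemma bounded_op_is_linear f : linear f.
Proof. by case: f => f /= /[!inE] -[]. Qed.

HB.instance Definition _ f :=
  GRing.isLinear.Build R X Y _ (f : X -> Y) (bounded_op_is_linear f).

Lemma bounded_op_continuous f : continuous f.
Proof. by case: f => f /= /[!inE] -[]. Qed.

Lemma bounded_opP f g : f =1 g -> f = g.
Proof. by move=> fg; apply/val_inj/funext. Qed.

Lemma bounded_op0E x : (0 : {bounded X -> Y}) x = 0. Proof. by []. Qed.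
Lemma bounded_opNE f x : (- f) x = - f x. Proof. by []. Qed.
Lemma bounded_opDE f g x : (f + g) x = f x + g x. Proof. by []. Qed.
Lemma bounded_opZE a f x : (a *: f) x = a *: f x. Proof. by []. Qed.

Definition opnorm f : R := sup [set `|f x| | x in [set x : X | `|x| <= 1]].

Lemma opnorm_has_sup f : has_sup [set `|f x| | x in [set x : X | `|x| <= 1]].
Proof.
split; first by exists `|f 0|, 0; rewrite //= normr0.
have /(linear_bounded_continuous f)/linear_boundedP := @bounded_op_continuous f.
move=> /pinfty_ex_gt0[M M0 fM]; exists M => _ [x /= x1 <-].
by rewrite (le_trans (fM x))// ler_piMr// ltW.
Qed.

Lemma opnorm_ge0 f : 0 <= opnorm f.
Proof.
apply: (@le_trans _ _ `|f 0|) => //.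
by apply: sup_upper_bound; [exact: opnorm_has_sup|exists 0; rewrite //= normr0].
Qed.

Lemma le_opnorm f x : `|f x| <= opnorm f * `|x|.
Proof.
have [->|x0] := eqVneq x 0; first by rewrite linear0 !normr0 mulr0.
have nx0 : 0 < `|x| by rewrite normr_gt0.
rewrite -ler_pdivrMr//; apply: sup_upper_bound; first exact: opnorm_has_sup.
exists (`|x|^-1 *: x) => /=.
  by rewrite normrZ ger0_norm ?invr_ge0// mulVf ?gt_eqF.
by rewrite linearZ normrZ ger0_norm ?invr_ge0// mulrC.
Qed.

Lemma opnorm_le f M : 0 <= M -> (forall x, `|f x| <= M * `|x|) -> opnorm f <= M.
Proof.
move=> M0 fM; apply: ge_sup; first by case: (opnorm_has_sup f).
by move=> _ [x /= x1 <-]; rewrite (le_trans (fM x))// ler_piMr.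
Qed.

Lemma ler_opnormD f g : opnorm (f + g) <= opnorm f + opnorm g.
Proof.
apply: opnorm_le => [|x]; first by rewrite addr_ge0 ?opnorm_ge0.
by rewrite (le_trans (ler_normD _ _))// mulrDl lerD ?le_opnorm.
Qed.

Lemma opnormZ a f : opnorm (a *: f) = `|a| * opnorm f.
Proof.
have le b h : opnorm (b *: h) <= `|b| * opnorm h.
  apply: opnorm_le => [|x]; first by rewrite mulr_ge0 ?opnorm_ge0.
  by rewrite bounded_opZE normrZ -mulrA ler_wpM2l ?le_opnorm.
apply/le_anti; rewrite le/=.
have [->|a0] := eqVneq a 0; first by rewrite normr0 mul0r opnorm_ge0.
have := le a^-1 (a *: f).
by rewrite scalerA mulVf// scale1r normfV ler_pdivlMl ?normr_gt0.
Qed.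

Lemma opnorm0_eq0 f : opnorm f = 0 -> f = 0.
Proof.
move=> f0; apply: bounded_opP => x; apply/eqP; rewrite -normr_le0.
by rewrite (le_trans (le_opnorm f x))// f0 mul0r.
Qed.

End BoundedOperatorTheory.

HB.instance Definition _ (R : realType) (X Y : normedModType R) :=
  Lmodule_isNormed.Build R {bounded X -> Y}
    (@ler_opnormD R X Y) (@opnormZ R X Y) (@opnorm0_eq0 R X Y).

Section BanachSpaceNotions.
Context {R : realType}.
Implicit Types X Y Z : normedModType R.

(* The canonical embedding of X into its bidual is onto. *)
Definition reflexive_space X :=
  forall F : {bounded {bounded X -> R} -> R},
    exists x : X, forall f : {bounded X -> R}, F f = f x.

Definition weak_space X : topologicalType :=
  sup_topology (fun f : {bounded X -> R} =>
    Topological.on (initial_topology (f : X -> R))).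

Definition weakly_lower_semicontinuous X (I : X -> R) :=
  lower_semicontinuous (fun x : weak_space X => (I x)%:E).

(* The filter of the limits for |x| --> +oo. *)
Definition norm_infty X : set_system X :=
  filter_from [set: R] (fun r => [set x : X | r < `|x|]).

Arguments norm_infty : clear implicits.

Global Instance norm_infty_filter X : Filter (norm_infty X).
Proof.
apply: filter_from_filter; first by exists 0.
move=> r s _ _; exists (Num.max r s) => // x /=.
by rewrite gt_max => /andP[].
Qed.

Definition coercive X (I : X -> R) := I @ norm_infty X --> +oo.

(* 'd f x is only meaningful, and only known to be continuous, when f is
   differentiable at x; elsewhere the value is irrelevant. *)
Definition frechet X Y (f : X -> Y) (x : X) : {bounded X -> Y} :=
  insubd 0 ('d f x : X -> Y).

Lemma frechetE X Y (f : X -> Y) (x : X) : differentiable f x ->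
  frechet f x = 'd f x :> (X -> Y).
Proof.
move=> dfx; rewrite /frechet -[LHS]/(val _) insubdK// inE; split.
  exact: linearP.
exact: diff_continuous.
Qed.

Definition C1 X Y (f : X -> Y) :=
  (forall x, differentiable f x) /\ continuous (frechet f).

Definition compact_operator X Z (A : X -> Z) :=
  continuous A /\ forall B : set X, bounded_set B -> precompact (A @` B).

Definition admits_continuous_inverse X (I : X -> R) :=
  exists2 J : {bounded X -> R} -> X, continuous J & cancel (frechet I) J.

Definition global_min X (J : X -> R) (x : X) := forall z, J x <= J z.

Definition theta_star X (I psi : X -> R) : \bar R :=
  ereal_inf [set (I x / psi x)%:E | x in [set x | 0 < psi x]].

Definition theta_tilde X (I psi : X -> R) : \bar R :=
  if `[< bounded_set [set x | 0 < psi x] >] then +oo%E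
  else limf_einf (fun x => (I x / psi x)%:E)
         (within [set x | 0 < psi x] (norm_infty X)).

(* The derivative at x of z |-> <phi z, y>, with y frozen. *)
Definition partial_x X Y (dot : {dot Y for idfun}) (phi : X -> Y)
    (x : X) (y : Y) : {bounded X -> R} :=
  frechet (fun z => dot (phi z) y) x.

End BanachSpaceNotions.

Arguments norm_infty {R} X _ : assert.

(* Main.v *)
(* Put E_y = I - <phi(.), y> - lambda psi and F = E_0 + |phi|^2 / 2. A global
   minimum of F solves the first equation. If 0 is the only solution, then
   F >= F 0 = 0. Since F x is the supremum over y in S of
   g(x, y) = E_y x - |y|^2 / 2, while sup_y inf_x g(x, y) < 0 because E_0 takes
   negative values, a minimax theorem forces some E_y to have two distinct
   global minima; a mountain pass argument on E_y, whose Palais-Smale condition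
   comes from the continuous inverse of I', yields the third critical point.
   Compactness in the weak topology is handled with ultrafilters: in a
   reflexive space, every ultrafilter containing a bounded set converges
   weakly. *)
From HB Require Import structures.
Require Import Defs.
From mathcomp Require Import all_boot all_order all_algebra.
From mathcomp Require Import all_classical all_reals all_analysis.
From mathcomp Require Import sesquilinear ring lra.

Import Order.TTheory GRing.Theory Num.Theory.
Import numFieldNormedType.Exports.

Local Open Scope classical_set_scope.
Local Open Scope ring_scope.

(** * Weak limits of ultrafilters *)

(** The coupling [g] is concave in [y] but has no convexity in [x]. If no [y] in [S] is suitable,
    the third critical point rules out two distinct global minima of [E_y], and this uniqueness of
    minimizers does in the minimax argument what convexity usually does. The term [- |y|^2 / 2]
    comes from completing the square: [g x (- y)] equals [F x - |phi x - y|^2 / 2], so the supremum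
    over all of [Y] is [F x], reached at [- phi x]. That point need not lie in [S]; density of [S]
    and continuity in [y] bridge the gap. The two bounds on lambda act separately. Below theta
    tilde, and with [0 <= lambda], [I - lambda psi] dominates a positive multiple of [I] near
    infinity, and the growth condition on [phi] then makes [E_y] coercive for [y] in [T]. Above
    theta star, [E_0] is negative at some point [x1]. This point keeps [g] below a negative constant
    for small [y]; for large [y] the point [0] does, since [E_y 0 = 0]. *)

Lemma fmap_ultra (T U : Type) (f : T -> U) (F : set_system T) :
  UltraFilter F -> UltraFilter (f @ F).
Proof.
move=> FU; split=> [|G GF fG]; first exact: fmap_proper_filter.
rewrite eqEsubset; split=> // A GA.
have [//|FA] := in_ultra_setVsetC (f @^-1` A) FU.
have GnA : G (~` A) by exact: fG.
by have /(@filter_ex _ G)[? []] : G (A `&` ~` A) by exact: filterI.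
Qed.

(** As values are totally ordered, the sublevel sets at points of [A] form a filter base; the point
    granted to an ultrafilter refining it lies below every value. The hypothesis merges compactness
    and lower semicontinuity, so that weakly compact and norm compact sets are treated alike. *)
Lemma ultra_min (R : realType) (T : Type) (A : set T) (g : T -> R) :
  A !=set0 ->
  (forall F : set_system T, UltraFilter F -> F A ->
     exists2 x, A x & forall c, F [set z | g z <= c] -> g x <= c) ->
  exists2 x, A x & forall z, A z -> g x <= g z.
Proof.
move=> [a Aa] cA.
pose F := filter_from A (fun x => [set z | A z /\ g z <= g x]).
have FF : ProperFilter F.
  apply: filter_from_proper; last by move=> x Ax; exists x => /=; split.
  apply: filter_from_filter; first by exists a.
  move=> x y Ax Ay; have [xy|yx] := lerP (g x) (g y).
    by exists x => // z [Az zx]; split; split => //; exact: le_trans xy.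
  by exists y => // z [Az zx]; split; split => //; exact: le_trans (ltW yx).
have [G [GU FG]] := ultraFilterLemma FF.
have GA : G A by apply: FG; exists a => // z [].
have [x Ax gx] := cA G GU GA; exists x => // z Az; apply: gx.
by apply: FG; exists z => // u [].
Qed.

Lemma ler_norm_bounded {R : realType} {X Y : normedModType R}
  (f : {bounded X -> Y}) x : `|f x| <= `|f| * `|x|.
Proof. exact: le_opnorm. Qed.

Definition weak_cvg {R : realType} {X : normedModType R}
    (F : set_system X) (x : X) :=
  forall f : {bounded X -> R}, f z @[z --> F] --> f x.

(** Only ultrafilters containing a ball are tested: functionals with compact derivative converge
    along these, which is what makes the notion stable under compact perturbations. *)
Definition weak_lsc {R : realType} {X : normedModType R} (g : X -> R) :=
  forall (F : set_system X) (r : R) (x : X) (c : R),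
    UltraFilter F -> F [set z | `|z| <= r] -> weak_cvg F x ->
    F [set z | g z <= c] -> g x <= c.

Definition sublevel_bounded {R : realType} {X : normedModType R} (g : X -> R) :=
  forall c, exists r, forall x, g x <= c -> `|x| <= r.

Section Weak.
Context {R : realType} {X : normedModType R}.
Implicit Types (F : set_system X) (g : X -> R).

(* The limit functional [f |-> lim f @ F] is bounded by r on X^*; it belongs
   to X by reflexivity. *)
Lemma weak_ultra_cvg F r : reflexive_space X -> UltraFilter F ->
  F [set z | `|z| <= r] -> exists x, weak_cvg F x.
Proof.
move=> Xr FU Fr.
have r0 : 0 <= r by have [z /= zr] := filter_ex Fr; exact: le_trans zr.
have L (f : {bounded X -> R}) :
    exists l, f z @[z --> F] --> l /\ `|l| <= r * `|f|.
  have := @segment_compact R (- (r * `|f|)) (r * `|f|).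
  rewrite compact_ultra => /(_ (f @ F) (fmap_ultra _ _ f _ FU)).
  case=> [|l []].
    apply: (@filterS _ F _ _ _ _ Fr) => z /= zr.
    rewrite /= in_itv/= -ler_norml (le_trans (ler_norm_bounded f z))// mulrC.
    by rewrite ler_wpM2r.
  by rewrite /= in_itv/= -ler_norml => lr fl; exists l.
have [Lam /all_and2[LamF Lamr]] := choice L.
have lin : linear Lam.
  move=> a f h; apply: (cvg_unique _ (LamF (a *: f + h))) => //.
  by apply: cvgD; [apply: cvgZr|]; exact: LamF.
pose lLam := GRing.isLinear.Build _ _ _ _ Lam lin.
pose LL : {linear {bounded X -> R} -> R} := HB.pack Lam lLam.
have cont : continuous Lam.
  apply/(linear_bounded_continuous LL)/linear_boundedP.
  exists r; split; first exact: ger0_real.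
  move=> M rM f; rewrite (le_trans (Lamr f))// ler_wpM2r//; exact: ltW.
have LamB : Lam \in @bounded_linear R {bounded X -> R} R by rewrite inE.
have [x xE] := Xr (BoundedOp LamB).
by exists x => f; rewrite -xE; exact: LamF.
Qed.

Lemma weak_lsc_min g : reflexive_space X -> weak_lsc g -> sublevel_bounded g ->
  exists x, global_min g x.
Proof.
move=> Xr gl gb; have [r gr] := gb (g 0).
have [||x _ gx] := @ultra_min R X [set x | g x <= g 0] g.
- by exists 0 => /=.
- move=> F FU F0; have Fr : F [set z | `|z| <= r] by apply: filterS F0 => z /gr.
  have [x Fx] := weak_ultra_cvg F r Xr FU Fr.
  have gF c : F [set z | g z <= c] -> g x <= c.
    by move=> Fc; apply: (gl F r).
  by exists x => //=; exact: gF.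
exists x => z; have [/gx//|/ltW z0] := lerP (g z) (g 0).
by apply: le_trans z0; apply: gx => /=.
Qed.

Lemma weak_lsc_of_weakly_lower_semicontinuous g :
  weakly_lower_semicontinuous g -> weak_lsc g.
Proof.
move=> gl F r x c FU _ Fx Fc; rewrite leNgt; apply/negP => cx.
have [V xV gV] := gl x c ltac:(by rewrite lte_fin).
(* The weak topology is a supremum of initial topologies, so convergence may be checked one
   functional at a time. *)
have FxV : F --> (x : weak_space X).
  apply/cvg_sup => f; rewrite /= => A.
  rewrite /nbhs/= => -[B [[C oC <-] fx]] BA; apply: filterS BA _.
  by apply: (Fx f); exact: open_nbhs_nbhs.
have [z [/= zc zV]] := @filter_ex _ F _ _ (@filterI _ F _ _ _ Fc (FxV V xV)).
by have := gV z zV; rewrite lte_fin ltNge zc.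
Qed.

End Weak.

(** * A minimax theorem *)

Definition segment_closed {R : realType} {Y : normedModType R} (S : set Y) :=
  forall x y t, S x -> S y -> 0 <= t -> t <= 1 -> S ((1 - t) *: x + t *: y).

Lemma convex_segment_closed (R : realType) (Y : normedModType R) (S : set Y) :
  convex_set S -> segment_closed S.
Proof.
move=> Sc x y t Sx Sy t0 t1.
have := Sc y x (Itv01 t0 t1) (mem_set Sy) (mem_set Sx).
by rewrite inE /conv/= addrC.
Qed.

Section Minimax.
Context {R : realType} {Y : normedModType R}.

Lemma segment_closed_join (C : set Y) (v : Y) : segment_closed C ->
  segment_closed [set (1 - p.1) *: p.2 + p.1 *: v | p in `[0, 1] `*` C].
Proof.
move=> Cc _ _ t [[a x] [/= + Cx]] <- [[b y] [/= + Cy]] <- t0 t1.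
rewrite /= !in_itv/= => /andP[a0 a1] /andP[b0 b1].
pose p := (1 - t) * (1 - a); pose q := t * (1 - b).
have p0 : 0 <= p by rewrite mulr_ge0// subr_ge0.
have q0 : 0 <= q by rewrite mulr_ge0// subr_ge0.
pose s := (1 - t) * a + t * b.
have s0 : 0 <= s by rewrite addr_ge0// mulr_ge0// subr_ge0.
have spq : 1 - s = p + q by rewrite /s /p /q; ring.
have -> : (1 - t) *: ((1 - a) *: x + a *: v) + t *: ((1 - b) *: y + b *: v)
    = p *: x + q *: y + s *: v.
  by rewrite /p /q /s !scalerDr !scalerA scalerDl addrACA.
(* If the weights of [x] and [y] both vanish, the point is [v] and any base point in [C] serves;
   otherwise they are renormalized to a convex combination inside [C]. *)
have [pq0|pqn0] := eqVneq (p + q) 0.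
  have pE : p = 0 by lra.
  have qE : q = 0 by lra.
  exists (1, x) => /=; first by split => //=; rewrite in_itv/= ler01 lexx.
  have -> : s = 1 by lra.
  by rewrite pE qE subrr !scale0r !add0r.
have pq : 0 < p + q by rewrite lt_neqAle eq_sym pqn0 addr_ge0.
exists (s, (1 - q / (p + q)) *: x + (q / (p + q)) *: y) => /=.
  split => /=; first by rewrite in_itv/=; apply/andP; split; lra.
  apply: Cc => //; first by rewrite divr_ge0// ltW.
  by rewrite ler_pdivrMr// mul1r lerDr.
congr (_ + _); rewrite spq scalerDr !scalerA; congr (_ *: _ + _ *: _).
  by rewrite mulrBr mulr1 mulrC divfK// addrK.
by rewrite mulrC divfK.
Qed.

(** Stands in for the convex hull of a finite set. Adding one point means joining it to the previous
    set, and the join is the image of a compact product under a continuous map. *)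
Lemma compact_hull (S : set Y) (s : seq Y) (v : Y) : segment_closed S -> S v ->
  (forall y, y \in s -> S y) ->
  exists C : set Y, [/\ compact C, segment_closed C, C `<=` S, C v &
    forall y, y \in s -> C y].
Proof.
move=> Sc Sv; elim: s => [_|w s IH sS].
  exists [set v]; split=> //; first exact: compact_set1.
    by move=> x y t -> -> _ _; rewrite /= -scalerDl subrK scale1r.
  by move=> _ ->.
have [|C [cC Cc CS Cv sC]] := IH.
  by move=> y ys; apply: sS; rewrite inE ys orbT.
have Cjoin x : C x ->
    [set (1 - p.1) *: p.2 + p.1 *: w | p in `[0, 1] `*` C] x.
  move=> Cx; exists (0, x); last by rewrite /= subr0 scale1r scale0r addr0.
  by split => //=; rewrite in_itv/= lexx ler01.
exists [set (1 - p.1) *: p.2 + p.1 *: w | p in `[0, 1] `*` C]; split.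
- apply: (@continuous_compact (R * Y)%type Y); last first.
    by apply: compact_setX => //; exact: segment_compact.
  apply: continuous_subspaceT => p.
  apply: cvgD; apply: cvgZ.
  + by apply: cvgB; [exact: cvg_cst|exact: cvg_fst].
  + exact: cvg_snd.
  + exact: cvg_fst.
  + exact: cvg_cst.
- exact: segment_closed_join.
- move=> _ [[a x] [/= + Cx]] <-; rewrite /= in_itv/= => /andP[a0 a1].
  by apply: Sc => //; [exact: CS|apply: sS; rewrite inE eqxx].
- exact: Cjoin.
- move=> y; rewrite inE => /orP[/eqP ->|/sC]; last exact: Cjoin.
  exists (1, v); last by rewrite /= subrr scale0r scale1r add0r.
  by split => //=; rewrite in_itv/= lexx ler01.
Qed.

Context {X : normedModType R} (S : set Y) (g : X -> Y -> R) (r : R).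
Hypotheses (X_reflexive : reflexive_space X) (S_convex : segment_closed S)
  (g_lsc : forall y, S y -> weak_lsc (g ^~ y))
  (g_bounded : forall y, S y -> sublevel_bounded (g ^~ y))
  (g_continuous : forall x, continuous (g x))
  (g_concave : forall x y y' t, 0 <= t -> t <= 1 ->
     (1 - t) * g x y + t * g x y' <= g x ((1 - t) *: y + t *: y'))
  (g_unique : forall y x x', S y ->
     global_min (g ^~ y) x -> global_min (g ^~ y) x' -> x = x')
  (g_small : forall y, S y -> exists x, g x y <= r).

(* Let [y0] maximize [min_x g(x, .)] on a compact convex set containing the
   given points, and [x0] be the minimizer of [g(., y0)]. The minimizers for
   the parameters on a segment starting at [y0] converge weakly to [x0]; by
   concavity, the value at their limit [x0] of [g(., y)], for [y] the other
   end of the segment, is at most the maximum. *)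
Lemma minimax_finite (s : seq Y) : (forall y, y \in s -> S y) ->
  exists x, forall y, y \in s -> g x y <= r.
Proof.
case: s => [_|v s sS]; first by exists 0.
have Sv : S v by apply: sS; rewrite inE eqxx.
have [C [cC Cc CS Cv sC]] := @compact_hull S (v :: s) v S_convex Sv sS.
have /choice[m mE] : forall y, exists x, S y -> global_min (g ^~ y) x.
  move=> y; have [Sy|nSy] := pselect (S y); last by exists 0.
  have [x ?] := weak_lsc_min _ X_reflexive (g_lsc _ Sy) (g_bounded _ Sy).
  by exists x.
have [||y0 Cy0 y0max] := @ultra_min R Y C (fun y => - g (m y) y).
- by exists v.
- move: cC; rewrite compact_ultra => cC F FU FC.
  have [y [Cy Fy]] := cC F FU FC; exists y => // c Fc.
  rewrite lerNl.
  (* The minimum is an infimum of functions continuous in the parameter, hence upper semicontinuous: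
     [m y] is kept as a competitor for all nearby [z]. *)
  have : g (m y) z @[z --> F] --> g (m y) y.
    by apply: (cvg_comp _ _ Fy); exact: g_continuous.
  move=> /cvgr_to_ge; apply.
  apply: filterS (@filterI _ F _ _ _ FC Fc) => z [Cz /=].
  rewrite lerNl => /le_trans; apply.
  exact: (mE z (CS _ Cz)).
have Sy0 := CS _ Cy0.
have mr : g (m y0) y0 <= r.
  by have [x] := g_small _ Sy0; apply: le_trans; exact: mE.
exists (m y0) => y ys; apply: le_trans mr.
have Cy := sC _ ys; have Sy := CS _ Cy.
(* The shift by two keeps [t n < 1] and makes [t n / (1 - t n)] the harmonic sequence. *)
pose t (n : nat) : R := n.+2%:R^-1.
have t0 n : 0 < t n by rewrite invr_gt0.
have t1 n : t n < 1 by rewrite invf_lt1// ltr1n.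
pose yt n := (1 - t n) *: y0 + t n *: y.
have Cyt n : C (yt n) by apply: Cc => //; exact: ltW.
pose xt n := m (yt n).
pose h := g (m y0) y0.
have hyt n : g (xt n) (yt n) <= h.
  by have := y0max _ (Cyt n); rewrite lerN2.
have hconc n : (1 - t n) * g (xt n) y0 + t n * g (xt n) y <= h.
  by apply: le_trans (hyt n); apply: g_concave; exact: ltW.
have hy0 n : h <= g (xt n) y0 by exact: mE.
have hy n : g (xt n) y <= h.
  rewrite -(ler_pM2l (t0 n)); apply: (le_trans _ (_ : h - (1 - t n) * h <= _)).
    rewrite lerBrDl; apply: le_trans (hconc n); rewrite lerD2r ler_wpM2l//.
    by rewrite subr_ge0 ltW.
  by rewrite mulrBl mul1r opprB addrC subrK.
have hm n : g (m y) y <= g (xt n) y by exact: mE.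
(* The lower bound [g (m y) y] on [g (xt n) y] limits how much the second term of [hconc] can
   compensate, so [xt] is a minimizing sequence for [g ^~ y0]. *)
have hy0le n : g (xt n) y0 <= h + (t n / (1 - t n)) * (h - g (m y) y).
  have ht : 0 < 1 - t n by rewrite subr_gt0.
  rewrite -(ler_pM2l ht) mulrDr mulrA mulrCA divff ?mulr1 ?gt_eqF//.
  have := hconc n; have := ler_wpM2l (ltW (t0 n)) (hm n).
  rewrite mulrBl mul1r; lra.
have tcvg : t n / (1 - t n) @[n --> \oo] --> (0 : R).
  have -> : (fun n => t n / (1 - t n)) = (fun n => n.+1%:R^-1).
    apply/funext => n; rewrite /t -natr1.
    have : 0 < (n.+1%:R : R) by [].
    move: (n.+1%:R : R) => a a0; field.
    by rewrite !gt_eqF//; lra.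
  exact: cvg_harmonic.
have bcvg : h + t n / (1 - t n) * (h - g (m y) y) @[n --> \oo] --> h.
  rewrite -[X in _ --> X]addr0 -[X in _ --> _ + X](mul0r (h - g (m y) y)).
  by apply: cvgD; [exact: cvg_cst|apply: cvgMl].
have [U [UU UN]] := ultraFilterLemma (_ : ProperFilter (\oo : set_system nat)).
pose F := xt @ U.
have FU : UltraFilter F by exact: fmap_ultra.
have Fy0 c : h < c -> F [set z | g z y0 <= c].
  move=> hc; apply: UN; near=> n => /=.
  apply: le_trans (hy0le n) _; near: n.
  exact: (cvgr_le _ bcvg).
have [rr rrP] := g_bounded _ Sy0 (h + 1).
have Frr : F [set z | `|z| <= rr].
  have hF : F [set z | g z y0 <= h + 1] by apply: Fy0; rewrite ltrDl.
  by apply: (@filterS _ F _ _ _ _ hF) => z /rrP.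
have [x Fx] := weak_ultra_cvg F rr X_reflexive FU Frr.
have xmin : global_min (g ^~ y0) x.
  move=> z; apply: (@le_trans _ _ h); last exact: mE.
  apply/ler_addgt0Pr => e e0; apply: (g_lsc _ Sy0 F rr x) => //.
  by apply: Fy0; rewrite ltrDl.
rewrite -/h (g_unique y0 (m y0) x) //; last exact: mE.
apply: (g_lsc _ Sy F rr x) => //.
by apply: (@filterS _ U _ _ _ _ filterT) => n _; exact: hy.
Unshelve. all: by end_near. Qed.

(** The finite case gives the sublevel sets the finite intersection property. An ultrafilter
    containing them all contains a bounded set, and semicontinuity puts its weak limit in each of
    them. *)
Lemma minimax : exists x, forall y, S y -> g x y <= r.
Proof.
have [[v Sv]|S0] := pselect (S !=set0); last first.
  by exists 0 => y Sy; exfalso; apply: S0; exists y.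
have fI : finI S (fun y => [set x | g x y <= r]).
  move=> D DS; have [|x xP] := @minimax_finite (finmap.enum_fset D).
    by move=> y yD; apply: set_mem; exact: DS.
  by exists x => y yD; exact: xP.
have [F [FU FF]] := ultraFilterLemma (finI_filter fI).
have FS y : S y -> F [set x | g x y <= r].
  by move=> Sy; apply: FF; exists [set x | g x y <= r] => //; exact: finI_from1.
have [rr rrP] := g_bounded _ Sv r.
have Frr : F [set z | `|z| <= rr].
  by apply: (@filterS _ F _ _ _ _ (FS _ Sv)) => z /rrP.
have [x Fx] := weak_ultra_cvg F rr X_reflexive FU Frr.
by exists x => y Sy; apply: (g_lsc _ Sy F rr x) => //; exact: FS.
Qed.

End Minimax.

(** * Frechet derivatives *)

Lemma bounded_opBE (R : realType) (X Y : normedModType R)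
  (f g : {bounded X -> Y}) x : (f - g) x = f x - g x.
Proof. by []. Qed.

Section Differential.
Context {R : realType} {X : normedModType R}.

Lemma is_derive_line (V : normedModType R) (f : X -> V) (x v : X) (t : R) :
  differentiable f (x + t *: v) ->
  is_derive t 1 (fun s => f (x + s *: v)) (frechet f (x + t *: v) v).
Proof.
move=> df; rewrite frechetE//.
pose h (s : R) := x + s *: v.
have dh : is_diff t h ( *:%R ^~ v).
  rewrite -[( *:%R ^~ v)](add0r ( *:%R ^~ v : R -> X)).
  exact: (@is_diffD R R X (cst x) ( *:%R ^~ v) 0 ( *:%R ^~ v) t).
have dhf : differentiable h t by [].
have dfh : differentiable (f \o h) t by exact: differentiable_comp.
apply: DeriveDef; first exact/diff_derivable.
by rewrite deriveE// diff_comp//= diff_val scale1r.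
Qed.

Lemma mean_value (f : X -> R) (x z : X) : (forall u, differentiable f u) ->
  exists2 t : R, 0 <= t <= 1 &
    f z - f x = frechet f (x + t *: (z - x)) (z - x).
Proof.
move=> df; pose h t := f (x + t *: (z - x)).
have dh (t : R) : is_derive t 1 h (frechet f (x + t *: (z - x)) (z - x)).
  exact: is_derive_line.
have [|t] := @MVT_segment R h
    (fun t => frechet f (x + t *: (z - x)) (z - x)) 0 1 ler01.
- apply: continuous_subspaceT => t; apply: differentiable_continuous.
  by apply/derivable1_diffP; have [] := dh t.
- rewrite in_itv/= => t1.
  rewrite subr0 mulr1 /h scale1r scale0r addr0 subrKC => E.
  by exists t.
Qed.

(* By the mean value theorem K z - K x = p z (z - x), where p z ranges over a
   relatively compact set of functionals, hence converges in norm. *)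
Lemma weak_cvg_compact_frechet (K : X -> R) (F : set_system X) (r : R) (x : X) :
  (forall u, differentiable K u) ->
  (forall B : set X, bounded_set B -> precompact (frechet K @` B)) ->
  UltraFilter F -> F [set z | `|z| <= r] -> weak_cvg F x ->
  K z @[z --> F] --> K x.
Proof.
move=> dK cK FU Fr Fx; have FF : Filter F by exact: filter_filter.
have /choice[t tP] : forall z, exists t : R, 0 <= t <= 1 /\
    K z - K x = frechet K (x + t *: (z - x)) (z - x).
  by move=> z; have [t] := mean_value K x z dK; exists t.
pose p z := frechet K (x + t z *: (z - x)).
(* This ball contains every segment from [x] to a point [z] with [|z| <= r]. *)
pose B := [set u : X | `|u| <= `|x| + (r + `|x|)].
have bB : bounded_set B.
  exists (`|x| + (r + `|x|)); split; first exact: num_real.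
  by move=> M rM u /= /le_trans; apply; exact: ltW.
have := cK B bB; rewrite precompactE compact_ultra.
have FB : F [set z | B (x + t z *: (z - x))].
  apply: (@filterS _ F _ _ _ _ Fr) => z /= zr; rewrite /B/=.
  have [/andP[t0 t1] _] := tP z.
  rewrite (le_trans (ler_normD _ _))// lerD2l normrZ ger0_norm//.
  rewrite (@le_trans _ _ `|z - x|)// ?ler_piMl//.
  by rewrite (le_trans (ler_normB _ _))// lerD2r.
case/(_ (p @ F) (fmap_ultra _ _ p F FU)) => [|f [_ Ff]].
  apply: (@filterS _ F _ _ _ _ FB) => z Bz.
  apply: (@subset_closure _ (frechet K @` B) (p z)).
  by exists (x + t z *: (z - x)).
have Kp z : K z = K x + (p z (z - x)) by have [_ <-] := tP z; rewrite subrKC.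
(* The first term vanishes by norm convergence of [p z] against the bounded [z - x], the second by
   weak convergence tested on the fixed [f]. *)
have KE z : K z = K x + ((p z - f) (z - x) + (f z - f x)).
  by rewrite Kp bounded_opBE (linearB f) subrK.
suff pf0 : (p z - f) (z - x) @[z --> F] --> (0 : R).
  have fx0 : f z - f x @[z --> F] --> f x - f x.
    by apply: cvgB; [exact: Fx|exact: cvg_cst].
  rewrite (eq_cvg _ _ KE).
  by have := cvgD (cvg_cst (K x)) (cvgD pf0 fx0); rewrite subrr !addr0; exact.
have pf : `|p z - f| * (r + `|x|) @[z --> F] --> (0 : R).
  rewrite -(mul0r (r + `|x|)); apply: cvgMl.
  by apply/norm_cvg0P; rewrite -(subrr f); apply: cvgB => //; exact: cvg_cst.
apply/norm_cvg0P; apply: (squeeze_cvgr _ (cvg_cst 0) pf).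
apply: (@filterS _ F _ _ _ _ Fr) => z /= zr; rewrite normr_ge0/=.
apply: le_trans (ler_norm_bounded (p z - f) (z - x)) _; rewrite ler_wpM2l//.
by rewrite (le_trans (ler_normB _ _))// lerD2r.
Qed.

Lemma frechet_unique (V : normedModType R) (f : X -> V) x
    (A : {bounded X -> V}) :
  'd f x = A :> (X -> V) -> frechet f x = A.
Proof.
move=> dA; apply/val_inj; rewrite /frechet/= insubdK// dA.
by have := valP A.
Qed.

Lemma frechetD (V : normedModType R) (f g : X -> V) x :
  differentiable f x -> differentiable g x ->
  frechet (f + g) x = frechet f x + frechet g x.
Proof.
move=> df dg; apply: frechet_unique; rewrite diffD//.
by apply/funext => u; rewrite bounded_opDE !frechetE.
Qed.

Lemma frechetN (V : normedModType R) (f : X -> V) x :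
  differentiable f x -> frechet (- f) x = - frechet f x.
Proof.
move=> df; apply: frechet_unique; rewrite diffN//.
by apply/funext => u; rewrite bounded_opNE !frechetE.
Qed.

Lemma frechetZ (V : normedModType R) (f : X -> V) a x :
  differentiable f x -> frechet (a *: f) x = a *: frechet f x.
Proof.
move=> df; apply: frechet_unique; rewrite diffZ//.
by apply/funext => u; rewrite bounded_opZE !frechetE.
Qed.

Lemma frechet_comp_linear (V W : normedModType R) (l : {linear V -> W})
    (f : X -> V) x u : continuous l -> differentiable f x ->
  frechet (l \o f) x u = l (frechet f x u).
Proof.
move=> cl df; have dl : differentiable l (f x) by exact: linear_differentiable.
have dlf : differentiable (l \o f) x by exact: differentiable_comp.
by rewrite (frechetE dlf) (frechetE df) diff_comp// diff_lin.
Qed.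

Lemma cvg_difference_quotient (V : normedModType R) (f : X -> V) (x u : X) :
  differentiable f x ->
  t^-1 *: (f (x + t *: u) - f x) @[t --> 0^'+] --> frechet f x u.
Proof.
move=> df.
have [dh hE] : is_derive (0 : R) 1 (fun s => f (x + s *: u)) (frechet f x u).
  by have := @is_derive_line V f x u 0; rewrite scale0r addr0; apply.
rewrite -hE; apply: cvg_dnbhs_at_right; move: dh.
rewrite /derivable/derive/=.
by under eq_fun do rewrite scaler1 addr0 scale0r addr0.
Qed.

(** One-sided Fermat rule with slack [k]: it serves the approximate minima of Ekeland's principle as
    well as functionals that are minimal up to a second-order error. *)
Lemma frechet_ge (E : X -> R) x (k : R) (u : X) : differentiable E x ->
  (\forall t \near 0^'+, E x - k * t <= E (x + t *: u)) -> - k <= frechet E x u.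
Proof.
move=> dE kE; have := cvg_difference_quotient _ E x u dE.
move=> /cvgr_to_ge; apply; near=> t.
have t0 : 0 < t by [].
rewrite ler_pdivlMl// mulrC lerBrDl mulNr; near: t.
Unshelve. all: by end_near. Qed.

End Differential.

(** * Ekeland's variational principle *)

(** Stated for a bare function [d] on a subset [P], with sequential completeness and semicontinuity,
    because it is applied both to [X] with its norm and to paths with the sup distance, which carry
    no metric structure here. *)
Lemma ekeland (R : realType) (T : Type) (P : set T) (d : T -> T -> R)
    (f : T -> R) (m k : R) (u : T) :
  (forall x, P x -> d x x = 0) -> (forall x y, P x -> P y -> 0 <= d x y) ->
  (forall x y, d x y = d y x) ->
  (forall x y z, P x -> P y -> P z -> d x z <= d x y + d y z) ->
  (forall s : nat -> T, (forall n, P (s n)) ->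
     (forall e, 0 < e -> exists N, forall i j, (N <= i)%N -> (N <= j)%N ->
        d (s i) (s j) <= e) ->
     exists2 l, P l & d (s n) l @[n --> \oo] --> (0 : R)) ->
  (forall (s : nat -> T) l c, (forall n, P (s n)) -> P l ->
     d (s n) l @[n --> \oo] --> (0 : R) ->
     (\forall n \near \oo, f (s n) <= c) -> f l <= c) ->
  (forall x, P x -> m <= f x) -> 0 < k -> P u ->
  exists v, [/\ P v, f v + k * d u v <= f u &
    forall w, P w -> f v - k * d v w <= f w].
Proof.
move=> dxx d0 dC dD complete lsc fm k0 Pu.
(* The sets S (s n) below are nested, with diameters tending to 0. *)
pose S x := [set w | P w /\ f w + k * d x w <= f x].
have Sx x : P x -> S x x by move=> Px; split=> //; rewrite dxx// mulr0 addr0.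
have Strans x y z : P x -> S x y -> S y z -> S x z.
  move=> Px [Py xy] [Pz yz]; split => //.
  have := ler_wpM2l (ltW k0) (dD x y z Px Py Pz); rewrite mulrDr; lra.
have Sle x w : P x -> S x w -> f w <= f x.
  move=> Px [Pw]; have := mulr_ge0 (ltW k0) (d0 x w Px Pw); lra.
(* The next point almost minimizes [f] on the current set, with error [1 / (n + 1)]; this bounds the
   radius of the following set by that error divided by [k]. *)
have /choice[nxt nxtP] : forall p : nat * T, exists y, P p.2 ->
    S p.2 y /\ forall w, S p.2 w -> f y <= f w + p.1.+1%:R^-1.
  move=> [n x] /=; have [Px|nPx] := pselect (P x); last by exists x.
  pose A := f @` S x.
  have hA : has_inf A.
    split; first by exists (f x), x => //; exact: Sx.
    by exists m => _ [w [Pw _] <-]; exact: fm.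
  have n0 : 0 < n.+1%:R^-1 :> R by rewrite invr_gt0.
  have [_ [y Sy <-] yA] := inf_adherent n0 hA.
  exists y => _; split=> // w Sw; apply: le_trans (ltW yA) _; rewrite lerD2r.
  by apply: ge_inf; [exact: hA.2|exists w].
pose s := fix s n := if n is n'.+1 then nxt (n', s n') else u.
have Ps n : P (s n).
  by elim: n => [//|n IH] /=; have [[]] := nxtP (n, s n) IH.
have sS n : S (s n) (s n.+1) by have [] := nxtP (n, s n) (Ps n).
have sSle n j : (n <= j)%N -> S (s n) (s j).
  move=> /subnK <-; elim: (j - n)%N => [|i IH]; first exact: Sx.
  by apply: (Strans _ (s (i + n)%N)).
have sf n w : S (s n) w -> f (s n.+1) <= f w + n.+1%:R^-1.
  by have [_] := nxtP (n, s n) (Ps n); apply.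
have sd n w : S (s n.+1) w -> k * d (s n.+1) w <= n.+1%:R^-1.
  move=> Sw; rewrite -(lerD2l (f w)); apply: le_trans Sw.2 _.
  exact: sf (Strans _ _ _ (Ps n) (sS n) Sw).
have small e : 0 < e -> \forall n \near \oo, (n.+1%:R^-1 : R) <= e.
  by move=> e0; apply: (cvgr_le _ (@cvg_harmonic R)).
have [|v Pv sv] := complete s Ps.
  move=> e e0; have ke : 0 < k * (e / 2) by rewrite mulr_gt0// divr_gt0.
  have [N _ NP] := small _ ke.
  have sN i : (N.+1 <= i)%N -> d (s N.+1) (s i) <= e / 2.
    move=> Ni; rewrite -(ler_pM2l k0); apply: le_trans (NP N (leqnn N)).
    by apply: sd; exact: sSle.
  exists N.+1 => i j Ni Nj; apply: le_trans (dD _ (s N.+1) _ _ _ _) _ => //.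
  by rewrite (dC (s i)) [leRHS]splitr lerD ?sN.
have Sv n : S (s n) v.
  split => //; rewrite -lerBrDr; apply/ler_addgt0Pr => e e0.
  apply: (lsc s v) => //.
  have ek : 0 < e / k by rewrite divr_gt0.
  near=> j.
  have nj : (n <= j)%N by near: j; exact: nbhs_infty_ge.
  have [_ ] := sSle n j nj.
  have := ler_wpM2l (ltW k0) (dD (s n) (s j) v (Ps n) (Ps j) Pv).
  have : d (s j) v <= e / k by near: j; exact: (cvgr_le _ sv).
  rewrite ler_pdivlMr// mulrDr [k * d (s j) v]mulrC; lra.
exists v; split=> //; first exact: (Sv 0%N).2.
(* A violating [w] would belong to [S v], hence to every [S (s n)]; almost minimality of the [s n]
   then forces [f v <= f w]. *)
move=> w Pw; rewrite leNgt; apply/negP => wv.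
have Svw : S v w by split=> //; lra.
suff : f v <= f w.
  by have := mulr_ge0 (ltW k0) (d0 v w Pv Pw); lra.
apply/ler_addgt0Pr => e /small[N _ /(_ N (leqnn N)) /= Ne].
apply: le_trans (Sle _ _ (Ps N.+1) (Sv N.+1)) _.
apply: le_trans (sf N w _) _; last by rewrite lerD2l.
exact: Strans (Ps N) (Sv N) Svw.
Unshelve. all: by end_near. Qed.

(** * Mountain pass *)

Section Selection.
Context {R : realType} {X : normedModType R}.

(* Michael-type selection: normalized tent functions subordinate to a finite
   cover of [0, 1] average the locally constant selections. *)
Lemma continuous_selection (Q : R -> set X) :
  (forall t, segment_closed (Q t)) ->
  (forall t : R, 0 <= t <= 1 -> exists v, \forall s \near t, Q s v) ->
  exists v : R -> X, forall t : R, 0 <= t <= 1 ->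
    Q t (v t) /\ {for t, continuous v}.
Proof.
move=> Qc Qloc.
have /choice[v] : forall t : R, exists v,
    0 <= t <= 1 -> \forall s \near t, Q s v.
  move=> t; have [t01|t01] := boolP (0 <= t <= 1); last by exists 0.
  by have [v ?] := Qloc t t01; exists v.
move=> vP.
have /choice[d dP] : forall t : R, exists d : R, 0 < d /\
    (0 <= t <= 1 -> forall s, `|t - s| < d -> Q s (v t)).
  move=> t; have [t01|t01] := boolP (0 <= t <= 1); last by exists 1.
  have /nbhs_ballP[e e0 eQ] := vP t t01.
  by exists e; split=> // _ s ts; exact: eQ.
have := @segment_compact R 0 1; rewrite compact_cover.
case/(_ R `[0, 1]%classic (fun t => ball t (d t))) => [t _||D D01 Dcov].
- by apply: ball_open; exact: (dP t).1.
- by move=> t t01; exists t => //; apply: ballxx; exact: (dP t).1.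
pose w t s : R := Num.max 0 (d t - `|t - s|).
pose W s := \sum_(t <- finmap.enum_fset D) w t s.
pose V s := \sum_(t <- finmap.enum_fset D) w t s *: v t.
have w0 t s : 0 <= w t s by rewrite le_max lexx.
exists (fun s => (W s)^-1 *: V s) => s s01.
have W0 : 0 < W s.
  have [|t tD] := Dcov s; first by rewrite /= in_itv.
  rewrite /ball/= => ts.
  rewrite lt_neqAle sumr_ge0// andbT eq_sym psumr_neq0//.
  by apply/hasP; exists t => //=; rewrite lt_max subr_gt0 ts orbT.
split.
  (* The cone over Q s: unlike Q s, it is closed under binary sums. *)
  pose K (a : R) (u : X) := (a = 0 /\ u = 0) \/ (0 < a /\ Q s (a^-1 *: u)).
  have : K (W s) (V s); last by case => [[W0' _]|[]//]; rewrite W0' ltxx in W0.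
  rewrite /W /V big_seq [V in K _ V]big_seq.
  apply: (big_ind2 K) => [|a u b u'|t tD]; first by left.
    move=> [[-> ->]|[a0 Qa]]; first by rewrite !add0r.
    move=> [[-> ->]|[b0 Qb]]; first by rewrite !addr0; right.
    right; have ab : 0 < a + b by rewrite addr_gt0.
    split=> //.
    have -> : (a + b)^-1 *: (u + u') =
        (1 - b / (a + b)) *: (a^-1 *: u) + (b / (a + b)) *: (b^-1 *: u').
      rewrite scalerDr !scalerA; congr (_ *: _ + _ *: _); field;
        by rewrite ?andbT ?gt_eqF.
    apply: Qc => //; first by rewrite divr_ge0// ltW.
    by rewrite ler_pdivrMr// mul1r lerDr ltW.
  have := w0 t s; rewrite le_eqVlt => /orP[/eqP <-|wts].
    by left; rewrite scale0r.
  right; split=> //; rewrite scalerA mulVf ?gt_eqF// scale1r.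
  have t01 : 0 <= t <= 1 by have := D01 t tD; rewrite inE/= in_itv.
  by apply: (dP t).2 => //; move: wts; rewrite lt_max ltxx subr_gt0.
have cw t : {for s, continuous (w t)}.
  apply: continuous_max; first exact: cvg_cst.
  apply: cvgB; first exact: cvg_cst.
  by apply: cvg_norm; apply: cvgB; [exact: cvg_cst|exact: cvg_id].
apply: cvgZ.
  apply: cvgV; first by rewrite gt_eqF.
  by apply: cvg_big => [|t _]; [exact: add_continuous|exact: cw].
apply: cvg_big => [|t _]; first exact: add_continuous.
by apply: cvgZ; [exact: cw|exact: cvg_cst].
Qed.

End Selection.

(** Convergence along a proper filter finer than [\oo] replaces the extraction of a subsequence. The
    rate [1 / (n + 1)] is the one at which Ekeland's principle is applied. *)
Definition palais_smale {R : realType} {X : normedModType R} (E : X -> R) :=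
  forall u : nat -> X, (exists c, forall n, E (u n) <= c) ->
    (forall n, `|frechet E (u n)| <= n.+1%:R^-1) ->
    exists z : X, exists2 U : set_system nat, ProperFilter U &
      \oo `<=` U /\ u n @[n --> U] --> z.

Lemma bounded_op_cvg (R : realType) (X Y : normedModType R) (T : Type)
    (F : set_system T) (FF : Filter F) (f : T -> {bounded X -> Y}) (u : T -> X)
    (g : {bounded X -> Y}) (v : X) :
  f t @[t --> F] --> g -> u t @[t --> F] --> v ->
  f t (u t) @[t --> F] --> g v.
Proof.
move=> fg uv.
have fgn : `|f t - g| @[t --> F] --> (0 : R).
  by apply/norm_cvg0P; rewrite -(subrr g); apply: cvgB => //; exact: cvg_cst.
have h : `|f t - g| * `|u t| @[t --> F] --> (0 : R).
  by rewrite -(mul0r `|v|); apply: cvgM => //; exact: cvg_norm.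
have h' : (f t - g) (u t) @[t --> F] --> (0 : Y).
  apply/norm_cvg0P; apply: (squeeze_cvgr _ (cvg_cst 0) h).
  by apply: nearW => t; rewrite normr_ge0; exact: ler_norm_bounded.
have gu : g (u t) @[t --> F] --> g v.
  by apply: (cvg_comp _ _ uv); exact: bounded_op_continuous.
have -> : (fun t => f t (u t)) = (fun t => (f t - g) (u t) + g (u t)).
  by apply/funext => t; rewrite bounded_opBE subrK.
by rewrite -[g v]add0r; exact: cvgD.
Qed.

Section AlmostCritical.
Context {R : realType} {X : normedModType R}.

Lemma almost_critical (E : X -> R) (v : X) (k : R) : differentiable E v ->
  0 <= k -> (forall w, E v - k * `|v - w| <= E w) -> `|frechet E v| <= k.
Proof.
move=> dE k0 Ek; apply: opnorm_le => // x.
have fx y : - (k * `|y|) <= frechet E v y.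
  apply: frechet_ge => //; near=> t.
  have t0 : 0 < t by [].
  apply: le_trans (Ek _); rewrite opprD addNKr normrN normrZ gtr0_norm//.
  by rewrite -mulrA [t * _]mulrC.
rewrite ler_norml fx/= -lerN2 -linearN; apply: le_trans (fx _).
by rewrite normrN.
Unshelve. all: by end_near. Qed.

Lemma steep_direction (f : {bounded X -> R}) (k : R) : 0 <= k -> k < `|f| ->
  exists2 v, `|v| <= 1 & f v < - k.
Proof.
move=> k0 kf; apply: contrapT => nv.
have fk x : - (k * `|x|) <= f x.
  have [->|x0] := eqVneq x 0; first by rewrite linear0 normr0 mulr0 oppr0.
  have nx0 : 0 < `|x| by rewrite normr_gt0.
  rewrite leNgt; apply/negP => fx; apply: nv; exists (`|x|^-1 *: x).
    by rewrite normrZ gtr0_norm ?invr_gt0// mulVf ?gt_eqF.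
  rewrite linearZ/= -(ltr_pM2l nx0) mulrA divff ?gt_eqF// mul1r mulrN.
  by rewrite mulrC.
suff : `|f| <= k by rewrite leNgt kf.
apply: opnorm_le => // x.
rewrite ler_norml fk/= -lerN2 -linearN; apply: le_trans (fk _).
by rewrite normrN.
Qed.

End AlmostCritical.

(** * The complete space of paths between two points *)

Section PathSpace.
Context {R : realType}.

Definition sup01 (h : R -> R) : R := sup [set h t | t in `[0, 1]].

Lemma sup01_attained (h : R -> R) : continuous h ->
  exists t, [/\ 0 <= t <= 1, h t = sup01 h &
    forall s, 0 <= s <= 1 -> h s <= sup01 h].
Proof.
move=> ch; have [t t01 ht] := @EVT_max R h 0 1 ler01 (continuous_subspaceT ch).
have t01' : 0 <= t <= 1 by rewrite in_itv/= in t01.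
exists t; have hs : sup01 h = h t.
  apply/eqP; rewrite eq_le; apply/andP; split.
    by apply: ge_sup => [|_ [s s01 <-]]; [exists (h t), t|exact: ht].
  apply: sup_upper_bound; last by exists t.
  by split; [exists (h t), t|exists (h t) => _ [s s01 <-]; exact: ht].
rewrite hs; split=> // s s01; by apply: ht; rewrite in_itv.
Qed.

Lemma sup01_ge (h : R -> R) t : continuous h -> 0 <= t <= 1 -> h t <= sup01 h.
Proof. by move=> /sup01_attained[s [_ _]]; apply. Qed.

Lemma sup01_le (h : R -> R) c : continuous h ->
  (forall t, 0 <= t <= 1 -> h t <= c) -> sup01 h <= c.
Proof. by move=> /sup01_attained[t [t01 <- _]]; apply. Qed.

Definition clamp (t : R) : R := Num.min 1 (Num.max 0 t).

Lemma clamp01 t : 0 <= clamp t <= 1.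
Proof. by rewrite /clamp ge_min lexx/= le_min ler01 le_max lexx. Qed.

Lemma clampE t : 0 <= t <= 1 -> clamp t = t.
Proof. by move=> /andP[t0 t1]; rewrite /clamp max_r// min_r. Qed.

Lemma continuous_clamp : continuous clamp.
Proof.
move=> t; apply: continuous_min; first exact: cvg_cst.
by apply: continuous_max; [exact: cvg_cst|exact: cvg_id].
Qed.

Lemma cauchy_seq_cvg (V : completeNormedModType R) (s : nat -> V) :
  (forall e, 0 < e -> exists N, forall i j, (N <= i)%N -> (N <= j)%N ->
     `|s i - s j| <= e) ->
  exists l : V, s n @[n --> \oo] --> l.
Proof.
move=> sc; suff /cvg_ex[l sl] : cvg (s n @[n --> \oo]) by exists l.
apply: cauchy_cvg; apply: cauchy_exP => e e0.
have [N NP] := sc (e / 2) ltac:(by rewrite divr_gt0).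
exists (s N); suff : \forall n \near \oo, ball (s N) e (s n) by [].
near=> n; rewrite -ball_normE/=.
apply: (@le_lt_trans _ _ (e / 2)).
  by apply: NP => //; near: n; exact: nbhs_infty_ge.
by rewrite ltr_pdivrMr// ltr_pMr// ltr1n.
Unshelve. all: by end_near. Qed.

Context {X : completeNormedModType R}.

(* Constant outside [0, 1], so that sup01 separates paths. *)
Definition path_between (a b : X) (p : R -> X) :=
  [/\ continuous p, p 0 = a, p 1 = b & forall t, p (clamp t) = p t].

Definition path_dist (p q : R -> X) := sup01 (fun t => `|p t - q t|).

Lemma continuous_dist (p q : R -> X) : continuous p -> continuous q ->
  continuous (fun t => `|p t - q t|).
Proof.
by move=> cp cq t; apply: cvg_norm; apply: cvgB; [exact: cp|exact: cq].
Qed.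

Variables a b : X.
Local Notation P := (path_between a b).

Lemma path_dist_le p q c : P p -> P q ->
  path_dist p q <= c <-> forall t, `|p t - q t| <= c.
Proof.
move=> [cp _ _ pc] [cq _ _ qc]; have cpq := continuous_dist _ _ cp cq; split.
  move=> pqc t; rewrite -pc -qc; apply: le_trans pqc.
  exact: (sup01_ge _ _ cpq (clamp01 t)).
by move=> pqc; apply: sup01_le.
Qed.

Lemma path_dist_ge p q t : P p -> P q -> `|p t - q t| <= path_dist p q.
Proof. by move=> Pp Pq; apply: (path_dist_le p q _ Pp Pq).1. Qed.

(** Pointwise limits exist in [X]; letting one index go to infinity in the Cauchy estimate makes the
    convergence uniform, and three thirds of [e] give continuity of the limit. *)
Lemma path_complete (s : nat -> R -> X) : (forall n, P (s n)) ->
  (forall e, 0 < e -> exists N, forall i j, (N <= i)%N -> (N <= j)%N ->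
     path_dist (s i) (s j) <= e) ->
  exists2 l, P l & path_dist (s n) l @[n --> \oo] --> (0 : R).
Proof.
move=> Ps cs.
have /choice[l lP] : forall t : R, exists l : X, s n t @[n --> \oo] --> l.
  move=> t; apply: cauchy_seq_cvg => e /cs[N NP]; exists N => i j Ni Nj.
  by apply: le_trans (NP i j Ni Nj); exact: path_dist_ge.
have sl e : 0 < e -> exists N, forall n, (N <= n)%N ->
    forall t, `|s n t - l t| <= e.
  move=> /cs[N NP]; exists N => n Nn t.
  have : `|s n t - s m t| @[m --> \oo] --> `|s n t - l t|.
    by apply: cvg_norm; apply: cvgB => //; exact: cvg_cst.
  move=> /cvgr_to_le; apply; near=> m.
  apply: le_trans (path_dist_ge _ _ t (Ps n) (Ps m)) _; apply: NP => //.
  by near: m; exact: nbhs_infty_ge.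
have Pl : P l.
  split.
  - move=> t; apply/cvgrPdist_le => e e0.
    have e3 : 0 < e / 3 by rewrite divr_gt0.
    have [N NP] := sl _ e3; have NN := NP N (leqnn N).
    have [cN _ _ _] := Ps N.
    near=> u.
    have : `|s N t - s N u| <= e / 3.
      by near: u; move: (cN t) => /cvgrPdist_le; apply.
    have := NN t; have := NN u; rewrite [`|s N t - l t|]distrC => h1 h2 h3.
    rewrite (_ : l t - l u = (l t - s N t) + (s N t - s N u) + (s N u - l u)).
      apply: le_trans (ler_normD _ _) _.
      by apply: le_trans (lerD (ler_normD _ _) (lexx _)) _; lra.
    by rewrite !addrA !subrK.
  - apply: (cvg_unique _ (lP 0)) => //.
    have -> : (fun n => s n 0) = (fun=> a).
      by apply/funext => n; have [_ ->] := Ps n.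
    exact: cvg_cst.
  - apply: (cvg_unique _ (lP 1)) => //.
    have -> : (fun n => s n 1) = (fun=> b).
      by apply/funext => n; have [_ _ ->] := Ps n.
    exact: cvg_cst.
  - move=> t; apply: (cvg_unique _ (lP (clamp t))) => //.
    have -> : (fun n => s n (clamp t)) = (fun n => s n t).
      by apply/funext => n; have [_ _ _ ->] := Ps n.
    exact: lP.
exists l => //; apply/cvgrPdist_le => e e0.
have [N NP] := sl e e0; near=> n.
rewrite sub0r normrN ger0_norm; last first.
  by apply: le_trans (path_dist_ge _ _ 0 (Ps n) Pl); rewrite normr_ge0.
apply/(path_dist_le _ _ _ (Ps n) Pl); apply: NP.
by near: n; exact: nbhs_infty_ge.
Unshelve. all: by end_near. Qed.

End PathSpace.

Section MountainPass.
Context {R : realType} {X : completeNormedModType R}.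
Variables (E : X -> R) (E_C1 : C1 E).

Lemma C1_continuous : continuous E.
Proof. by move=> x; apply: differentiable_continuous; exact: E_C1.1. Qed.

Lemma continuous_along (p : R -> X) : continuous p -> continuous (E \o p).
Proof. by move=> cp t; apply: (cvg_comp _ _ (cp t)); exact: C1_continuous. Qed.

(* If the derivative of E is steep at all the highest points of the path,
   moving the path along a continuous selection of descent directions
   contradicts minimality. *)
Lemma path_almost_critical (a b : X) (p : R -> X) (k : R) :
  path_between a b p -> 0 < k ->
  E a < sup01 (E \o p) -> E b < sup01 (E \o p) ->
  (forall q, path_between a b q ->
     sup01 (E \o p) - k * path_dist p q <= sup01 (E \o q)) ->
  exists t, E (p t) = sup01 (E \o p) /\ `|frechet E (p t)| <= k.
Proof.
move=> Pp k0 aM bM pmin; set M := sup01 (E \o p) in aM bM pmin *.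
apply: contrapT => noncrit.
have [cp p0 p1 pc] := Pp.
have cEp : continuous (E \o p) by exact: continuous_along.
have EpM t : 0 <= t <= 1 -> E (p t) <= M by exact: sup01_ge.
have steep t : E (p t) = M -> k < `|frechet E (p t)|.
  by move=> tM; rewrite ltNge; apply/negP => tk; apply: noncrit; exists t.
(* The last clause fixes the endpoints of the moved path. It cannot clash with the descent clause,
   since [E] is below [M] at both ends. *)
pose Q (t : R) : set X := [set v | [/\ `|v| <= 1,
  E (p t) = M -> frechet E (p t) v < - k & t = 0 \/ t = 1 -> v = 0]].
have [|t t01|v vQ] := @continuous_selection R X Q.
- move=> t x y s [x1 xM x0] [y1 yM y0] s0 s1; have s1' : 0 <= 1 - s by lra.
  split.
  + apply: le_trans (ler_normD _ _) _.
    rewrite !normrZ !ger0_norm//.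
    have := ler_wpM2l s0 y1; have := ler_wpM2l s1' x1; lra.
  + move=> tM; rewrite linearD !linearZ/=.
    have := xM tM; have := yM tM.
    move: (frechet E (p t) x) (frechet E (p t) y) => u w uk wk.
    have [s_0|s_0] := eqVneq s 0.
      by rewrite s_0 subr0 scale1r scale0r addr0.
    have sp : 0 < s by rewrite lt_neqAle eq_sym s_0.
    have : (1 - s) * u <= (1 - s) * - k by rewrite ler_wpM2l// ltW.
    have : s * w < s * - k by rewrite ltr_pM2l.
    by rewrite /GRing.scale/=; lra.
  + by move=> tb; rewrite x0// y0// !scaler0 addr0.
(* Below the top level the zero vector works nearby; at the top, a steep direction stays steep
   nearby because the derivative is continuous. *)
- have [tM|tM] := eqVneq (E (p t)) M; last first.
    exists 0; near=> s; split; first by rewrite normr0.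
    + move=> sM; suff : E (p s) < M by rewrite sM ltxx.
      near: s; apply: (cvgr_lt (E (p t))); first exact: (cEp t).
      by rewrite lt_neqAle tM EpM.
    + by [].
  have [v v1 vk] := steep_direction _ _ (ltW k0) (steep _ tM).
  exists v; near=> s; split; first exact: v1.
    move=> _; near: s; apply: (cvgr_lt (frechet E (p t) v)) vk.
    apply: bounded_op_cvg; last exact: cvg_cst.
    by apply: (cvg_comp p (frechet E) (cp t)); exact: E_C1.2.
  have sa : E a < E (p s).
    by near: s; apply: (cvgr_gt (E (p t))); [exact: (cEp t)|rewrite tM].
  have sb : E b < E (p s).
    by near: s; apply: (cvgr_gt (E (p t))); [exact: (cEp t)|rewrite tM].
  move=> [s0|s1]; first by move: sa; rewrite s0 p0 ltxx.
  by move: sb; rewrite s1 p1 ltxx.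
pose w t := v (clamp t).
have cw : continuous w.
  move=> t; apply: (cvg_comp clamp v (continuous_clamp t)).
  exact: (vQ _ (clamp01 t)).2.
have w1 t : `|w t| <= 1 by have [[]] := vQ _ (clamp01 t).
pose s (n : nat) : R := n.+1%:R^-1.
have s0 n : 0 < s n by rewrite invr_gt0.
have s1 n : s n <= 1 by rewrite invf_le1// ler1n.
have scvg : s n @[n --> \oo] --> (0 : R) by exact: cvg_harmonic.
pose q n t := p t + s n *: w t.
have Pq n : path_between a b (q n).
  split.
  - by move=> t; apply: cvgD; [exact: cp|apply: cvgZr; exact: cw].
  - rewrite /q /w clampE ?lexx ?ler01// p0.
    have [[_ _ ->]] := vQ 0 (introT andP (conj (lexx 0) ler01)); last by left.
    by rewrite scaler0 addr0.
  - rewrite /q /w clampE ?lexx ?ler01// p1.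
    have [[_ _ ->]] := vQ 1 (introT andP (conj ler01 (lexx 1))); last by right.
    by rewrite scaler0 addr0.
  - by move=> t; rewrite /q /w pc (clampE (clamp t)) ?clamp01.
have dq n : path_dist p (q n) <= s n.
  apply/(path_dist_le _ _ _ _ _ Pp (Pq n)) => t.
  by rewrite /q opprD addNKr normrN normrZ gtr0_norm// ler_piMr// ltW.
(* [t n] is a highest point of the moved path [q n]. As [q n] is within [s n] of [p],
   near-minimality of [p] bounds the loss of height by [k * s n]. *)
have /choice[t tP] : forall n, exists t : R,
    0 <= t <= 1 /\ M - k * s n <= E (q n t).
  move=> n; have cq : continuous (E \o q n).
    by apply: continuous_along; have [] := Pq n.
  have [t [t01 tq _]] := sup01_attained _ cq; exists t; split=> //.
  rewrite [E (q n t)]tq; apply: le_trans (pmin _ (Pq n)); rewrite lerD2l lerN2.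
  by rewrite ler_wpM2l// ltW.
have /choice[th thP] : forall n, exists th : R, 0 <= th <= 1 /\
    E (q n (t n)) - E (p (t n)) =
    frechet E (p (t n) + th *: (s n *: w (t n))) (s n *: w (t n)).
  move=> n; have [th th01] := mean_value E (p (t n)) (q n (t n)) E_C1.1.
  by rewrite /q addrAC subrr add0r => thE; exists th.
have slope n : - k <= frechet E (p (t n) + th n *: (s n *: w (t n))) (w (t n)).
  have [_] := thP n; rewrite linearZ => thE.
  rewrite -(ler_pM2l (s0 n)).
  apply: (@le_trans _ _ (E (q n (t n)) - E (p (t n)))); last by rewrite thE.
  by have := EpM _ (tP n).1; have := (tP n).2; lra.
(* In the limit of the [t n] the point lies at height [M], while the slopes keep the bound [- k];
   this contradicts the strict descent imposed by [Q] there. *)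
have [U [UU UN]] := ultraFilterLemma (_ : ProperFilter (\oo : set_system nat)).
have FU : Filter U by exact: filter_filter.
have := @segment_compact R 0 1.
rewrite compact_ultra => /(_ (t @ U) (fmap_ultra _ _ t U UU)).
case=> [|t' [/= t'01 tt']].
  apply: (@filterS _ U _ _ _ _ filterT) => n _.
  by rewrite /= in_itv; exact: (tP n).1.
rewrite in_itv/= in t'01.
have sU : s n @[n --> U] --> (0 : R) by apply: cvg_trans scvg; exact: cvg_app.
have wU : w (t n) @[n --> U] --> w t' by apply: (cvg_comp t w tt'); exact: cw.
have pU : p (t n) @[n --> U] --> p t' by apply: (cvg_comp t p tt'); exact: cp.
have swU : s n *: w (t n) @[n --> U] --> (0 : X).
  by rewrite -(scale0r (w t')); exact: cvgZ.
have thU : th n *: (s n *: w (t n)) @[n --> U] --> (0 : X).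
  have h : `|s n *: w (t n)| @[n --> U] --> (0 : R) by apply/norm_cvg0P.
  apply/norm_cvg0P; apply: (squeeze_cvgr _ (cvg_cst 0) h); apply: nearW => n.
  have [/andP[th0 th1] _] := thP n.
  by rewrite normr_ge0/= normrZ ger0_norm// ler_piMl.
have t'M : E (p t') = M.
  apply/eqP; rewrite eq_le EpM//=.
  have EqU : E (q n (t n)) @[n --> U] --> E (p t').
    apply: (cvg_comp (fun n => q n (t n)) E); last exact: C1_continuous.
    by rewrite -[p t']addr0; exact: cvgD.
  have : E (q n (t n)) + k * s n @[n --> U] --> E (p t').
    rewrite -[E (p t')]addr0 -[X in _ --> _ + X](mulr0 k).
    by apply: cvgD => //; apply: cvgMr.
  move=> /cvgr_to_ge; apply; apply: nearW => n.
  by have [_] := tP n; lra.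
have ptU : p (t n) + th n *: (s n *: w (t n)) @[n --> U] --> p t'.
  by rewrite -[X in _ --> X]addr0; exact: cvgD.
have : frechet E (p (t n) + th n *: (s n *: w (t n))) (w (t n)) @[n --> U]
    --> frechet E (p t') (w t').
  apply: bounded_op_cvg => //.
  exact: (cvg_comp _ (frechet E) ptU (E_C1.2 (p t'))).
move=> /cvgr_to_ge - /(_ (- k)); have h : \forall n \near U, - k <=
    frechet E (p (t n) + th n *: (s n *: w (t n))) (w (t n)) by exact: nearW.
move=> /(_ h).
have [[_ + _] _] := vQ _ t'01 => /(_ t'M).
by rewrite /w (clampE t')// => h1 h2; have := le_lt_trans h2 h1; rewrite ltxx.
Unshelve. all: by end_near. Qed.

End MountainPass.

(** * A third critical point between two global minima *)

Section ThirdCriticalPoint.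
Context {R : realType} {X : completeNormedModType R}.
Variables (E : X -> R) (E_C1 : C1 E) (E_PS : palais_smale E).

Lemma global_min_critical (x : X) : global_min E x -> frechet E x = 0.
Proof.
move=> xmin; apply/eqP; rewrite -normr_le0.
by apply: almost_critical => // [|w]; [exact: E_C1.1|rewrite mul0r subr0].
Qed.

Lemma palais_smale_critical (u : nat -> X) :
  (exists c, forall n, E (u n) <= c) ->
  (forall n, `|frechet E (u n)| <= n.+1%:R^-1) ->
  exists z : X, [/\ frechet E z = 0 & exists2 U : set_system nat,
    ProperFilter U & \oo `<=` U /\ u n @[n --> U] --> z].
Proof.
move=> uc uE; have [z [U UU [UN uz]]] := E_PS _ uc uE.
exists z; split; last by exists U.
apply/eqP; rewrite -normr_le0.
have Ez : `|frechet E (u n)| @[n --> U] --> `|frechet E z|.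
  by apply: cvg_norm; exact: (cvg_comp u (frechet E) uz (E_C1.2 z)).
apply/ler_addgt0Pr => e e0; rewrite add0r; move: Ez => /cvgr_to_le; apply.
apply: UN; near=> n; apply: le_trans (uE n) _; near: n.
exact: (cvgr_le _ (@cvg_harmonic R)).
Unshelve. all: by end_near. Qed.

(* Ekeland's principle turns a minimizing sequence on the sphere into a
   Palais-Smale sequence at vanishing distance from the sphere. *)
Lemma sphere_gap (x1 : X) (r : R) : global_min E x1 ->
  (forall z, `|z - x1| = r -> frechet E z <> 0) ->
  exists2 eta, 0 < eta & forall x, `|x - x1| = r -> E x1 + eta <= E x.
Proof.
move=> x1min noncrit; apply: contrapT => nogap.
have k0 n : 0 < (n.+1%:R^-1 : R) by rewrite invr_gt0.
(* The excess is the square of the Ekeland constant [1 / (n + 1)], so that both the displacement and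
   the slope are at most [1 / (n + 1)]. *)
have /choice[x xP] : forall n, exists x : X,
    `|x - x1| = r /\ E x < E x1 + n.+1%:R^-1 ^+ 2.
  move=> n; apply: contrapT => nx; apply: nogap; exists (n.+1%:R^-1 ^+ 2).
    by rewrite exprn_gt0.
  by move=> x xr; rewrite leNgt; apply/negP => xlt; apply: nx; exists x.
have /choice[v vP] : forall n, exists v : X, [/\ `|x n - v| <= n.+1%:R^-1,
    E v <= E (x n) & forall w, E v - n.+1%:R^-1 * `|v - w| <= E w].
  move=> n.
  have [|||||||v [_ xv vw]] := @ekeland R X setT (fun y z => `|y - z|) E
    (E x1) n.+1%:R^-1 (x n) _ _ _ _ _ _ _ (k0 n) I.
  - by move=> y _; rewrite subrr normr0.
  - by [].
  - by move=> y z; exact: distrC.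
  - by move=> y z t _ _ _; exact: ler_distD.
  - move=> s _ sc.
    have [l sl] := cauchy_seq_cvg X s sc.
    exists l => //; apply/norm_cvg0P; rewrite -(subrr l).
    by apply: cvgB => //; exact: cvg_cst.
  - move=> s l c _ _ sl sc.
    have Esl : E (s n) @[n --> \oo] --> E l.
      apply: (cvg_comp s E); last exact: C1_continuous.
      by apply/subr_cvg0; apply/norm_cvg0P.
    by move: Esl => /cvgr_to_le; apply.
  - by move=> y _; exact: x1min.
  move: xv => /= xv; exists v; split=> //; last by move=> w; exact: vw.
    rewrite -(ler_pM2l (k0 n)) -expr2.
    rewrite -(lerD2l (E x1)); apply: le_trans (ltW (xP n).2).
    by apply: le_trans xv; rewrite lerD2r; exact: x1min.
  by apply: le_trans xv; rewrite lerDl mulr_ge0// ltW.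
have [||z [z0 [U UU [UN vz]]]] := palais_smale_critical v.
- exists (E x1 + 1) => n; have [_ vx _] := vP n; apply: le_trans vx _.
  apply: le_trans (ltW (xP n).2) _; rewrite lerD2l.
  by rewrite exprn_ile1// ?invr_ge0// invf_le1// ler1n.
- move=> n; have [_ _ vw] := vP n.
  by apply: almost_critical; [exact: E_C1.1|exact: ltW|].
apply: (noncrit z) => //.
have UF : Filter U by exact: filter_filter.
have xv0 : x n - v n @[n --> U] --> (0 : X).
  apply: (cvg_trans (cvg_app _ UN)); apply/norm_cvg0P.
  apply: (squeeze_cvgr _ (cvg_cst 0) (@cvg_harmonic R)); apply: nearW => n.
  by rewrite normr_ge0; have [] := vP n.
have xz : `|x n - x1| @[n --> U] --> `|z - x1|.
  apply: cvg_norm; apply: cvgB; last exact: cvg_cst.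
  rewrite -[z]add0r (_ : x = fun n => (x n - v n) + v n); first exact: cvgD.
  by apply/funext => n; rewrite subrK.
apply: (cvg_unique _ xz) => //.
rewrite (_ : (fun n => _) = fun=> r); first exact: cvg_cst.
by apply/funext => n; have [] := xP n.
Unshelve. all: by end_near. Qed.

(** Every path from [x1] to [x2] crosses a sphere on which [E] exceeds its minimum by a fixed gap.
    Ekeland's principle on paths gives a Palais-Smale sequence above that gap, so its critical limit
    is neither of the two minima. *)
Lemma third_critical_point (x1 x2 : X) : x1 != x2 ->
  global_min E x1 -> global_min E x2 ->
  exists x3, [/\ x3 != x1, x3 != x2 & frechet E x3 = 0].
Proof.
move=> x12 x1min x2min; apply: contrapT => noncrit.
have crit z : frechet E z = 0 -> z = x1 \/ z = x2.
  move=> z0; have [|z1] := eqVneq z x1; first by left.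
  have [|z2] := eqVneq z x2; first by right.
  by exfalso; apply: noncrit; exists z.
have E12 : E x1 = E x2 by apply/eqP; rewrite eq_le x1min x2min.
pose D := `|x2 - x1|.
have D0 : 0 < D by rewrite normr_gt0 subr_eq0 eq_sym.
(* The only critical points, [x1] and [x2], lie at distances [0] and [D] from [x1], so the sphere of
   radius [D / 2] is free of them. *)
have [z zr z0|eta eta0 gap] := sphere_gap x1 (D / 2) x1min.
  have [zx|zx] := crit z z0; move: zr; rewrite zx ?subrr ?normr0 -?/D; lra.
have high p : path_between x1 x2 p -> E x1 + eta <= sup01 (E \o p).
  move=> [cp p0 p1 pc].
  have cn : continuous (fun t => `|p t - x1|).
    by apply: continuous_dist => // t; exact: cvg_cst.
  have [||t t01 tD] := @IVT R (fun t => `|p t - x1|) 0 1 (D / 2) ler01.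
  - exact: continuous_subspaceT.
  - rewrite p0 p1 subrr normr0 -/D min_l ?max_r ?ltW//; lra.
  rewrite in_itv/= in t01; apply: le_trans (gap (p t) tD) _.
  by apply: sup01_ge => //; exact: continuous_along.
pose p0 (t : R) := x1 + clamp t *: (x2 - x1).
have Pp0 : path_between x1 x2 p0.
  split.
  - move=> t; apply: cvgD; first exact: cvg_cst.
    by apply: cvgZ; [exact: continuous_clamp|exact: cvg_cst].
  - by rewrite /p0 clampE ?lexx ?ler01// scale0r addr0.
  - by rewrite /p0 clampE ?lexx ?ler01// scale1r subrKC.
  - by move=> t; rewrite /p0 (clampE (clamp t)) ?clamp01.
have k0 n : 0 < (n.+1%:R^-1 : R) by rewrite invr_gt0.
have /choice[u uP] : forall n, exists u : X, [/\ E x1 + eta <= E u,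
    E u <= sup01 (E \o p0) & `|frechet E u| <= n.+1%:R^-1].
  move=> n.
  have [|||||||p [Pp pp0 pmin]] := @ekeland R (R -> X) (path_between x1 x2)
    path_dist (fun p => sup01 (E \o p)) (E x1 + eta) n.+1%:R^-1 p0
    _ _ _ _ _ _ _ (k0 n) Pp0.
  - move=> p Pp; apply/eqP; rewrite eq_le; apply/andP; split.
      by apply/(path_dist_le _ _ _ _ _ Pp Pp) => t; rewrite subrr normr0.
    by apply: le_trans (path_dist_ge _ _ _ _ 0 Pp Pp).
  - by move=> p q Pp Pq; apply: le_trans (path_dist_ge _ _ _ _ 0 Pp Pq).
  - move=> p q; rewrite /path_dist; congr sup01.
    by apply/funext => t; exact: distrC.
  - move=> p q s Pp Pq Ps; apply/(path_dist_le _ _ _ _ _ Pp Ps) => t.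
    apply: le_trans (ler_distD (q t) _ _) _.
    by apply: lerD; exact: (path_dist_ge x1 x2).
  - exact: path_complete.
  - move=> s l c Ps Pl sl sc; apply: sup01_le.
      by apply: continuous_along => //; have [] := Pl.
    move=> t t01.
    have stl : s n t @[n --> \oo] --> l t.
      apply/subr_cvg0; apply/norm_cvg0P; apply: (squeeze_cvgr _ (cvg_cst 0) sl).
      by apply: nearW => i; rewrite normr_ge0 (path_dist_ge x1 x2).
    have Estl : E (s n t) @[n --> \oo] --> E (l t).
      by apply: (cvg_comp _ E stl); exact: C1_continuous.
    move: Estl => /cvgr_to_le; apply; apply: filterS sc => i; apply: le_trans.
    have [csi _ _ _] := Ps i.
    exact: (sup01_ge _ _ (continuous_along _ E_C1 _ csi) t01).
  - by move=> p /high.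
  have hp := high p Pp.
  have [||t [tM tk]] :=
    path_almost_critical E E_C1 x1 x2 p _ Pp (k0 n) _ _ pmin.
  - by apply: lt_le_trans hp; rewrite ltrDl.
  - by apply: lt_le_trans hp; rewrite -E12 ltrDl.
  exists (p t); split=> //; rewrite tM//.
  apply: le_trans pp0; rewrite lerDl mulr_ge0//.
  by apply: le_trans (path_dist_ge _ _ _ _ 0 Pp0 Pp).
have [||z [z0 [U UU [UN uz]]]] := palais_smale_critical u.
- by exists (sup01 (E \o p0)) => n; have [] := uP n.
- by move=> n; have [] := uP n.
have : E x1 + eta <= E z.
  have Euz : E (u n) @[n --> U] --> E z.
    by apply: (cvg_comp _ E uz); exact: C1_continuous.
  by move: Euz => /cvgr_to_ge; apply; apply: nearW => n; have [] := uP n.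
by have [->|->] := crit z z0; rewrite -?E12; lra.
Unshelve. all: by end_near. Qed.

End ThirdCriticalPoint.

(** * Compact perturbations *)

Section Hilbert.
Context {R : realType} {Y : completeNormedModType R} (dot : {dot Y for idfun}).
Implicit Types u v w : Y.

Lemma dotDl u v w : dot (u + v) w = dot u w + dot v w.
Proof. exact: linearDl. Qed.

Lemma dotZl a u v : dot (a *: u) v = a * dot u v.
Proof. exact: linearZl. Qed.

Lemma dotC u v : dot u v = dot v u.
Proof. by rewrite hermC/= mul1r. Qed.

Lemma dotDr u v w : dot u (v + w) = dot u v + dot u w.
Proof. exact: linearDr. Qed.

Lemma dotZr a u v : dot u (a *: v) = a * dot u v.
Proof. by rewrite dotC dotZl dotC. Qed.

Lemma dotNr u v : dot u (- v) = - dot u v.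
Proof. exact: linearNr. Qed.

Lemma dot0l u : dot 0 u = 0.
Proof. exact: linear0l. Qed.

Hypothesis dotE : forall y : Y, dot y y = `|y| ^+ 2.

Lemma sqr_normB u v :
  `|u - v| ^+ 2 = `|u| ^+ 2 - 2 * dot u v + `|v| ^+ 2.
Proof.
rewrite -!dotE dotDl !dotDr !dotNr (dotC (- v) u) dotNr (dotC (- v) v) dotNr.
ring.
Qed.

Lemma dot_le u v : `|dot u v| <= `|u| * `|v|.
Proof.
suff le x y : dot x y <= `|x| * `|y|.
  rewrite ler_norml le andbT -lerN2 opprK -dotNr.
  by apply: le_trans (le _ _) _; rewrite normrN.
have [->|x0] := eqVneq x 0; first by rewrite dot0l normr0 mul0r.
have [->|y0] := eqVneq y 0; first by rewrite dotC dot0l normr0 mulr0.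
have nx : 0 < `|x| by rewrite normr_gt0.
have ny : 0 < `|y| by rewrite normr_gt0.
(* Expanded, the square is twice [|x| * |y|] times [|x| * |y| - dot x y]. *)
have := sqr_ge0 `| `|y| *: x - `|x| *: y |.
rewrite sqr_normB !normrZ !normr_id dotZl dotZr.
have nxy : 0 < `|x| * `|y| by rewrite mulr_gt0.
move=> h; rewrite -(ler_pM2l nxy); move: h.
by move: (dot x y) `|x| `|y| => d a b; lra.
Qed.

Lemma dotr_bounded (y : Y) : dot^~ y \in @bounded_linear R Y R.
Proof.
have lin : linear (dot^~ y) by move=> a u v; rewrite dotDl dotZl.
pose mix := GRing.isLinear.Build _ _ _ _ (dot^~ y) lin.
pose L : {linear Y -> R} := HB.pack (dot^~ y) mix.
rewrite inE; split=> //.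
apply/(linear_bounded_continuous L)/linear_boundedP.
exists `|y|; split; first exact: num_real.
move=> M yM u; apply: le_trans (dot_le u y) _; rewrite mulrC.
by rewrite ler_wpM2r//; exact: ltW.
Qed.

Definition dotr (y : Y) : {bounded Y -> R} := BoundedOp (dotr_bounded y).

Lemma dotrE y u : dotr y u = dot u y. Proof. by []. Qed.

Lemma continuous_dotr (u : Y) : continuous (dot u).
Proof.
move=> y; have -> : dot u = dotr u by apply/funext => v; rewrite dotrE dotC.
exact: bounded_op_continuous.
Qed.

Context {X : completeNormedModType R}.

Lemma comp_dotr_bounded (y : Y) (A : {bounded X -> Y}) :
  (fun x => dot (A x) y) \in @bounded_linear R X R.
Proof.
rewrite inE; split=> [a u v|x]; first by rewrite linearP dotDl dotZl.
have cA : A z @[z --> x] --> A x by exact: bounded_op_continuous.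
have cy : dotr y u @[u --> A x] --> dotr y (A x).
  exact: bounded_op_continuous.
exact: (cvg_comp A (dotr y) cA cy).
Qed.

Definition comp_dotr (y : Y) (A : {bounded X -> Y}) : {bounded X -> R} :=
  BoundedOp (comp_dotr_bounded y A).

Lemma continuous_comp_dotr (y : Y) : continuous (comp_dotr y).
Proof.
move=> A.
apply/(@cvgrPdist_le R {bounded X -> R} _ (nbhs A) (nbhs_filter A)) => e e0.
(* The map is Lipschitz with constant [|y|]; adding one avoids dividing by zero when [y = 0]. *)
have y0 : 0 < `|y| + 1 by rewrite ltr_wpDl.
have ey : 0 < e / (`|y| + 1) by rewrite divr_gt0.
have := (@cvgrPdist_le R {bounded X -> Y} _ (nbhs A) (nbhs_filter A) id A).1
  cvg_id _ ey.
apply: (@filterS _ (nbhs A) (nbhs_filter A)) => B AB.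
apply: opnorm_le => [|x]; first exact: ltW.
have -> : (comp_dotr y A - comp_dotr y B) x = dot ((A - B) x) y.
  by rewrite bounded_opBE [RHS]linearBl.
apply: le_trans (dot_le _ _) _.
apply: le_trans (ler_wpM2r _ (ler_norm_bounded (A - B) x)) _ => //.
rewrite mulrAC ler_wpM2r//; apply: le_trans (ler_wpM2r _ AB) _ => //.
by rewrite mulrAC ler_pdivrMr// ler_pM2l// lerDl.
Qed.

Variable (phi : X -> Y).
Hypothesis phi_diff : forall x, differentiable phi x.

Lemma differentiable_dot y x : differentiable (fun z => dot (phi z) y) x.
Proof.
apply: (@differentiable_comp _ _ _ _ phi (dotr y)); first exact: phi_diff.
apply: linear_differentiable; exact: bounded_op_continuous.
Qed.

(** The chain rule for a bounded functional. In this form, compactness of [frechet phi] passes to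
    the partial derivative through a continuous map. *)
Lemma partial_x_comp_dotr y :
  (fun x => partial_x dot phi x y) = comp_dotr y \o frechet phi.
Proof.
apply/funext => x; apply: bounded_opP => u.
apply: (frechet_comp_linear _ _ (dotr y) phi x u); last exact: phi_diff.
exact: bounded_op_continuous.
Qed.

Lemma partial_xN x y : partial_x dot phi x (- y) = - partial_x dot phi x y.
Proof.
have E z : partial_x dot phi x z = comp_dotr z (frechet phi x).
  exact: (congr1 (fun f => f x) (partial_x_comp_dotr z)).
by apply: bounded_opP => u; rewrite !E bounded_opNE /= dotNr.
Qed.

End Hilbert.

Section CompactOperators.
Context {R : realType} {X Z W : normedModType R}.

Lemma compact_operator_comp (A : X -> Z) (h : Z -> W) :
  compact_operator A -> continuous h -> compact_operator (h \o A).
Proof.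
move=> [cA pA] ch; split.
  by move=> x; apply: (cvg_comp A h (cA x)); exact: ch.
move=> B /pA; rewrite precompactE => cB.
apply: (@precompact_subset _ _ (h @` closure (A @` B))).
  move=> _ [x Bx <-]; exists (A x) => //; apply: subset_closure.
  by exists x.
apply: compact_precompact; first exact: norm_hausdorff.
by apply: continuous_compact => //; exact: continuous_subspaceT.
Qed.

Lemma compact_operatorD (A B : X -> Z) :
  compact_operator A -> compact_operator B ->
  compact_operator (fun x => A x + B x).
Proof.
move=> [cA pA] [cB pB]; split.
  by move=> x; apply: cvgD; [exact: cA|exact: cB].
move=> D bD; have := pA D bD; rewrite precompactE => cAD.
have := pB D bD; rewrite precompactE => cBD.
pose add (p : Z * Z) := p.1 + p.2.
apply: (@precompact_subset _ _
  (add @` (closure (A @` D) `*` closure (B @` D)))).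
  move=> _ [x Dx <-]; exists (A x, B x) => //.
  by split; apply: subset_closure; exists x.
apply: compact_precompact; first exact: norm_hausdorff.
apply: continuous_compact; last exact: compact_setX.
by apply: continuous_subspaceT; exact: add_continuous.
Qed.

End CompactOperators.

Section CompactPerturbation.
Context {R : realType} {X : completeNormedModType R}.
Variables (I K : X -> R).
Hypotheses (I_C1 : C1 I) (K_diff : forall x, differentiable K x)
  (K_compact : compact_operator (frechet K)).

Lemma C1B : C1 (I - K).
Proof.
split=> x; first by apply: differentiableB; [exact: I_C1.1|exact: K_diff].
have -> : frechet (I - K) = fun x => frechet I x - frechet K x.
  apply/funext => y; rewrite frechetD ?frechetN//; first exact: I_C1.1.
  exact: differentiableN.
by apply: cvgB; [exact: I_C1.2|exact: K_compact.1].
Qed.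

Lemma frechetB x : frechet (I - K) x = frechet I x - frechet K x.
Proof.
rewrite frechetD ?frechetN//; first exact: I_C1.1.
exact: differentiableN.
Qed.

(** The sequence is bounded, so the derivatives of [K] cluster at some [f]; those of [I] then
    converge to the same [f], and the continuous inverse carries this back to the sequence
    itself. *)
Lemma palais_smaleB : admits_continuous_inverse I ->
  sublevel_bounded (I - K) -> palais_smale (I - K).
Proof.
move=> [J cJ IJ] sb u [c uc] uE.
have [r rP] := sb c.
have [U [UU UN]] := ultraFilterLemma (_ : ProperFilter (\oo : set_system nat)).
have UF : Filter U by exact: filter_filter.
have bB : bounded_set [set x : X | `|x| <= r].
  exists r; split; first exact: num_real.
  by move=> M rM x /= /le_trans; apply; exact: ltW.
have := K_compact.2 _ bB; rewrite precompactE compact_ultra.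
case/(_ ((fun n => frechet K (u n)) @ U) (fmap_ultra _ _ _ U UU)) =>
    [|f [_ Uf]].
  apply: (@filterS _ U _ _ _ _ filterT) => n _.
  apply: (@subset_closure _ (frechet K @` [set x | `|x| <= r])
    (frechet K (u n))).
  by exists (u n) => //=; exact: rP.
have E0 : frechet (I - K) (u n) @[n --> U] --> (0 : {bounded X -> R}).
  apply: (cvg_trans (cvg_app _ UN)); apply/norm_cvg0P.
  apply: (squeeze_cvgr _ (cvg_cst 0) (@cvg_harmonic R)); apply: nearW => n.
  by rewrite normr_ge0 uE.
have If : frechet I (u n) @[n --> U] --> f.
  have -> : (fun n => frechet I (u n)) =
      (fun n => frechet (I - K) (u n) + frechet K (u n)).
    by apply/funext => n; rewrite frechetB subrK.
  by rewrite -[f]add0r; exact: cvgD.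
exists (J f), U; first exact: ultra_proper.
split=> //; have -> : u = fun n => J (frechet I (u n)).
  by apply/funext => n; rewrite IJ.
by apply: (cvg_comp _ J If); exact: cJ.
Qed.

(** [K] converges along bounded weakly convergent ultrafilters, so it only shifts the level by an
    arbitrarily small [e]. *)
Lemma weak_lscB : weak_lsc I -> weak_lsc (I - K).
Proof.
move=> Il F r x c FU Fr Fx Fc.
have FF : Filter F by exact: filter_filter.
rewrite -[(I - K) x]/(I x - K x) lerBlDr; apply/ler_addgt0Pr => e e0.
apply: (Il F r) => //.
have Kx := weak_cvg_compact_frechet K F r x K_diff K_compact.2 FU Fr Fx.
have Ke : \forall z \near F, K z <= K x + e.
  by apply: (cvgr_le (K x)) => //; rewrite ltrDl.
apply: (@filterS2 _ F _ _ _ _ _ Fc Ke) => z /=.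
rewrite -[(I - K) z]/(I z - K z); lra.
Qed.

End CompactPerturbation.

Lemma sublevel_bounded_coercive (R : realType) (X : normedModType R)
    (g : X -> R) :
  (forall c, \forall x \near norm_infty X, c < g x) -> sublevel_bounded g.
Proof.
move=> gc c; have [r _ rP] := gc c; exists r => x xc.
rewrite leNgt; apply/negP => rx.
by have := rP x rx; rewrite /= ltNge xc.
Qed.

Lemma sublevel_bounded_shift (R : realType) (X : normedModType R)
    (g h : X -> R) a :
  sublevel_bounded g -> (forall x, g x + a <= h x) -> sublevel_bounded h.
Proof.
move=> gb gh c; have [r rP] := gb (c - a); exists r => x xc; apply: rP.
by rewrite lerBrDr; apply: le_trans xc.
Qed.

Lemma weak_lsc_shift (R : realType) (X : normedModType R) (g h : X -> R) a :
  weak_lsc g -> (forall x, h x = g x + a) -> weak_lsc h.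
Proof.
move=> gl hg F r x c FU Fr Fx Fc; rewrite hg -lerBrDr; apply: (gl F r) => //.
by apply: (@filterS _ F _ _ _ _ Fc) => z /=; rewrite hg -lerBrDr.
Qed.

(** * The functionals of the theorem *)

Section Coercivity.
Context {R : realType} {X : normedModType R}.
Variables (I psi : X -> R) (lambda : R).
Hypotheses (I_coercive : coercive I) (lambda_ge0 : 0 <= lambda)
  (lambda_lt : (lambda%:E < theta_tilde I psi)%E).

Lemma coercive_gt c : \forall x \near norm_infty X, c < I x.
Proof. by move/cvgryPgt : I_coercive; apply. Qed.

(** Some [mu] above [lambda] still satisfies [mu * psi <= I] far away where [psi] is positive, which
    leaves a fixed fraction of [I]; where [psi <= 0], the sign of [lambda] makes the subtracted term
    help. *)
Lemma coercive_theta_tilde : exists2 delta, 0 < delta &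
  \forall x \near norm_infty X, delta * I x <= I x - lambda * psi x.
Proof.
have [mu mu_gt muP] : exists2 mu, lambda < mu &
    \forall x \near norm_infty X, 0 < psi x -> mu * psi x <= I x.
  move: lambda_lt; rewrite /theta_tilde; case: asboolP => [bpsi _|_].
    (* Any [mu] above [lambda] would do: no point far away has [psi] positive. *)
    exists (lambda + 1); first by rewrite ltrDl.
    have [M [_ Mpsi]] := bpsi; exists (M + 1) => // x /= Mx psix.
    have /= := Mpsi (M + 1) _ x psix.
    by rewrite ltrDl => /(_ ltr01); rewrite leNgt Mx.
  rewrite limf_einfE => /ereal_sup_gt[_ [V FV <-] lV].
  have [mu lmu muV] : exists2 mu, lambda < mu &
      (mu%:E <= ereal_inf [set (I x / psi x)%:E | x in V])%E.
    move: lV; case: (ereal_inf _) => [s|_|//].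
      by rewrite lte_fin => ls; exists s.
    by exists (lambda + 1); rewrite ?ltrDl// leey.
  have {}FV : norm_infty X (fun x => 0 < psi x -> V x) := FV.
  exists mu => //; apply: (@filterS _ (norm_infty X) _ _ _ _ FV) => x Vx psix.
  have {}Vx := Vx psix.
  rewrite -ler_pdivlMr// -lee_fin; apply: le_trans muV _.
  by apply: ereal_inf_lbound; exists x.
have mu0 : 0 < mu by exact: le_lt_trans mu_gt.
(* From [psi <= I / mu] follows [I - lambda psi >= (1 - lambda / mu) * I]. *)
exists ((mu - lambda) / mu); first by rewrite divr_gt0// subr_gt0.
near=> x.
have Ix : 0 < I x by near: x; exact: coercive_gt.
have psiI : 0 < psi x -> mu * psi x <= I x by near: x; exact: muP.
rewrite mulrAC ler_pdivrMr//.
have [psix|psix] := ltrP 0 (psi x).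
  by have := ler_wpM2l lambda_ge0 (psiI psix); lra.
have := mulr_ge0_le0 lambda_ge0 psix.
move/(ler_wpM2l (ltW mu0)); rewrite mulr0.
have := mulr_ge0 lambda_ge0 (ltW Ix); lra.
Unshelve. all: by end_near. Qed.

End Coercivity.

Section Functional.
Context {R : realType} {X Y : completeNormedModType R}
  (dot : {dot Y for idfun}).
Hypothesis dotE : forall y : Y, dot y y = `|y| ^+ 2.
Variables (I psi : X -> R) (phi : X -> Y) (lambda : R).
Hypotheses (X_reflexive : reflexive_space X)
  (I_C1 : C1 I) (psi_C1 : C1 psi) (phi_C1 : C1 phi)
  (I_wlsc : weakly_lower_semicontinuous I)
  (phi_compact : compact_operator (frechet phi))
  (psi_compact : compact_operator (frechet psi)).

Definition energy (y : Y) (x : X) : R := I x - dot (phi x) y - lambda * psi x.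

Let K (y : Y) : X -> R := (fun x => dot (phi x) y) + (lambda *: psi).

Lemma energyE y : energy y = I - K y.
Proof.
apply/funext => x.
by rewrite -[RHS]/(I x - (dot (phi x) y + lambda * psi x)) opprD addrA.
Qed.

Lemma K_diff y x : differentiable (K y) x.
Proof.
apply: differentiableD; last by apply: differentiableZ; exact: psi_C1.1.
by apply: differentiable_dot => //; exact: phi_C1.1.
Qed.

Lemma frechetK y x : frechet (K y) x =
  partial_x dot phi x y + lambda *: frechet psi x.
Proof.
rewrite frechetD; last 2 first.
- by apply: differentiable_dot => //; exact: phi_C1.1.
- by apply: differentiableZ; exact: psi_C1.1.
by rewrite frechetZ//; exact: psi_C1.1.
Qed.

Lemma K_compact y : compact_operator (frechet (K y)).
Proof.
have -> : frechet (K y) =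
    fun x => partial_x dot phi x y + lambda *: frechet psi x.
  by apply/funext => x; exact: frechetK.
apply: compact_operatorD.
  rewrite (partial_x_comp_dotr _ dotE _ phi_C1.1).
  by apply: compact_operator_comp => //; exact: continuous_comp_dotr.
apply: (@compact_operator_comp _ _ _ _ (frechet psi) ( *:%R lambda)) => //.
exact: scaler_continuous.
Qed.

Lemma energy_C1 y : C1 (energy y).
Proof. by rewrite energyE; exact: C1B _ _ I_C1 (K_diff y) (K_compact y). Qed.

Lemma energy_critical y x : frechet (energy y) x = 0 ->
  frechet I x = partial_x dot phi x y + lambda *: frechet psi x.
Proof.
rewrite energyE (frechetB _ _ I_C1 (K_diff y)) => /eqP.
by rewrite subr_eq0 frechetK => /eqP.
Qed.

Lemma energy_weak_lsc y : weak_lsc (energy y).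
Proof.
rewrite energyE; apply: (weak_lscB _ _ (K_diff y) (K_compact y)).
exact: weak_lsc_of_weakly_lower_semicontinuous.
Qed.

Lemma energy_palais_smale y : admits_continuous_inverse I ->
  sublevel_bounded (energy y) -> palais_smale (energy y).
Proof.
by rewrite energyE; exact: (palais_smaleB _ _ I_C1 (K_diff y) (K_compact y)).
Qed.

Definition penalized (x : X) : R := energy 0 x + 2^-1 * `|phi x| ^+ 2.

Lemma penalizedE x : penalized x = energy (- phi x) x - 2^-1 * `|phi x| ^+ 2.
Proof.
rewrite /penalized /energy dotNr dotE.
by rewrite [dot _ 0]dotC dot0l; lra.
Qed.

(** Completing the square in [y]. Read for fixed [y], it bounds [penalized] from below by a
    functional without quadratic term, touching it wherever [phi x = y]. *)
Lemma energy_penalized y x : energy (- y) x - 2^-1 * `|y| ^+ 2 =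
  penalized x - 2^-1 * `|phi x - y| ^+ 2.
Proof.
rewrite (sqr_normB _ dotE) /penalized /energy dotNr [dot _ 0]dotC dot0l.
lra.
Qed.

(** [penalized] is a supremum of weakly lower semicontinuous functionals; at the limit [x], the
    single one frozen at [phi x] attains it. *)
Lemma penalized_weak_lsc : weak_lsc penalized.
Proof.
move=> F r x c FU Fr Fx Fc; rewrite penalizedE lerBlDr.
apply: (energy_weak_lsc (- phi x) F r) => //.
apply: (@filterS _ F _ _ _ _ Fc) => z /= zc.
have := energy_penalized (phi x) z.
have := sqr_ge0 `|phi z - phi x|; lra.
Qed.

(* Up to a constant, [penalized] differs from [energy (- phi x)] by
   [|phi - phi x|^2 / 2], which vanishes to second order at x. *)
Lemma penalized_min_critical x : global_min penalized x ->
  frechet I x = - partial_x dot phi x (phi x) + lambda *: frechet psi x.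
Proof.
move=> xmin; rewrite -(partial_xN _ dotE _ phi_C1.1); apply: energy_critical.
(* Nonnegativity in every direction suffices, since applying it to [u] and [- u] makes a linear
   functional vanish. *)
have ge0 u : 0 <= frechet (energy (- phi x)) x u.
  apply/ler_addgt0Pr => k k0; rewrite addrC -lerBlDl sub0r.
  apply: frechet_ge; first exact: (energy_C1 _).1.
  pose del t := phi (x + t *: u) - phi x.
  have quot : t^-1 *: del t @[t --> 0^'+] --> frechet phi x u.
    exact: (cvg_difference_quotient _ phi x u (phi_C1.1 x)).
  have id0 : t @[t --> (0:R)^'+] --> (0 : R).
    by apply: cvg_at_right_filter; exact: cvg_id.
  (* This is [|del t|^2 / t], written through the convergent difference quotient so that the factor
     [t] sends it to zero. *)
  have quad : t * (`|t^-1 *: del t| * `|t^-1 *: del t|) @[t --> 0^'+]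
      --> (0 : R).
    have qn : `|t^-1 *: del t| @[t --> 0^'+] --> `|frechet phi x u|.
      by apply: cvg_norm; exact: quot.
    by have := cvgM id0 (cvgM qn qn); rewrite mul0r; exact.
  near=> t.
  have t0 : 0 < t by [].
  have tk : t * (`|t^-1 *: del t| * `|t^-1 *: del t|) <= k.
    by near: t; exact: (cvgr_le _ quad).
  have delk : `|del t| ^+ 2 <= k * t.
    rewrite -ler_pdivrMr//; apply: le_trans tk.
    rewrite -expr2 normrZ exprMn gtr0_norm ?invr_gt0//.
    rewrite (_ : t * (t^-1 ^+ 2 * `|del t| ^+ 2) = `|del t| ^+ 2 / t)//.
    by field; rewrite gt_eqF.
  have := energy_penalized (phi x) x.
  have := energy_penalized (phi x) (x + t *: u).
  rewrite subrr normr0 expr0n mulr0 subr0 -/(del t).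
  have := xmin (x + t *: u).
  have := mulr_ge0 (ltW k0) (ltW t0); lra.
apply: bounded_opP => u; apply/eqP; rewrite eq_le ge0 andbT.
by rewrite -lerN2 oppr0 -linearN ge0.
Unshelve. all: by end_near. Qed.

Lemma energy_concave x y y' t : 0 <= t -> t <= 1 ->
  (1 - t) * (energy y x - 2^-1 * `|y| ^+ 2)
    + t * (energy y' x - 2^-1 * `|y'| ^+ 2) <=
  energy ((1 - t) *: y + t *: y') x - 2^-1 * `|(1 - t) *: y + t *: y'| ^+ 2.
Proof.
move=> t0 t1; rewrite /energy dotDr !dotZr.
have t1' : 0 <= 1 - t by rewrite subr_ge0.
have : `|(1 - t) *: y + t *: y'| ^+ 2 <= (1 - t) * `|y| ^+ 2 + t * `|y'| ^+ 2.
  apply: (@le_trans _ _ (((1 - t) * `|y| + t * `|y'|) ^+ 2)).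
    rewrite lerXn2r ?nnegrE// ?addr_ge0 ?mulr_ge0//.
    by apply: le_trans (ler_normD _ _) _; rewrite !normrZ !ger0_norm.
  rewrite -subr_ge0.
  rewrite (_ : _ - _ = (1 - t) * t * (`|y| - `|y'|) ^+ 2); last by ring.
  by apply: mulr_ge0; [exact: mulr_ge0|exact: sqr_ge0].
lra.
Qed.

Lemma energy_continuous x : continuous (fun y => energy y x - 2^-1 * `|y| ^+ 2).
Proof.
move=> y; apply: cvgB.
  apply: cvgB; last exact: cvg_cst.
  apply: cvgB; first exact: cvg_cst.
  exact: continuous_dotr.
apply: cvgMr; under eq_fun do rewrite expr2.
by rewrite expr2; apply: cvgM; apply: cvg_norm; exact: cvg_id.
Qed.

End Functional.

Theorem theorem1 (R : realType) (X Y : completeNormedModType R)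
    (dot : {dot Y for idfun})
    (Y_hilbert : forall y : Y, dot y y = `|y| ^+ 2)
    (X_reflexive : reflexive_space X)
    (I psi : X -> R) (phi : X -> Y) (T : set Y)
    (I_C1 : C1 I) (psi_C1 : C1 psi) (phi_C1 : C1 phi)
    (I0 : I 0 = 0) (psi0 : psi 0 = 0) (phi0 : phi 0 = 0)
    (psi_sup_gt0 : (0 < ereal_sup (range (fun x => (psi x)%:E)))%E)
    (I_wlsc : weakly_lower_semicontinuous I)
    (I_coercive : coercive I)
    (I_inverse : admits_continuous_inverse I)
    (phi_compact : compact_operator (frechet phi))
    (psi_compact : compact_operator (frechet psi))
    (T_convex : convex_set T) (T_dense : dense T)
    (phi_o : forall y, T y ->
      dot (phi x) y / I x @[x --> norm_infty X] --> (0 : R))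
    (theta_lt : (theta_star I psi < theta_tilde I psi)%E) :
  forall lambda : R,
    (theta_star I psi < lambda%:E)%E -> (lambda%:E < theta_tilde I psi)%E ->
    0 <= lambda ->
    (exists2 x : X, x != 0 &
       frechet I x = - partial_x dot phi x (phi x) + lambda *: frechet psi x)
    \/
    (forall S : set Y, convex_set S -> S `<=` T -> dense S ->
       exists2 y : Y, S y &
         exists x1 x2 x3 : X,
           [/\ uniq [:: x1; x2; x3],
               forall x, x \in [:: x1; x2; x3] ->
                 frechet I x = partial_x dot phi x y + lambda *: frechet psi x,
               global_min (fun x => I x - dot (phi x) y - lambda * psi x) x1 &
               global_min (fun x => I x - dot (phi x) y - lambda * psi x) x2]).
Proof.
move=> lambda theta_star_lt lambda_lt lambda_ge0.
pose E := energy dot I psi phi lambda.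
have norm_inftyF : Filter (norm_infty X) by exact: norm_infty_filter.
have [delta delta0 deltaP] :=
  coercive_theta_tilde I psi lambda I_coercive lambda_ge0 lambda_lt.
have E0 x : E 0 x = I x - lambda * psi x.
  by rewrite /E /energy dotC dot0l subr0.
have E_bounded y : T y -> sublevel_bounded (E y).
  move=> Ty; apply: sublevel_bounded_coercive => c.
  (* Half of [delta * I] absorbs the term [dot (phi x) y]; the other half tends to infinity. *)
  have delta2 : 0 < delta / 2 by rewrite divr_gt0.
  near=> x.
  have Ix0 : 0 < I x by near: x; exact: coercive_gt.
  have Ixc : c / (delta / 2) < I x by near: x; exact: coercive_gt.
  have Jx : delta * I x <= I x - lambda * psi x by near: x; exact: deltaP.
  have : dot (phi x) y / I x <= delta / 2.
    by near: x; exact: (cvgr_le 0 (phi_o y Ty) (delta / 2) delta2).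
  rewrite ler_pdivrMr//; move: Ixc; rewrite ltr_pdivrMr// /E /energy; lra.
have F_bounded : sublevel_bounded (penalized dot I psi phi lambda).
  (* Treated apart from [E_bounded], as [0] need not belong to [T]. *)
  have J_bounded : sublevel_bounded (E 0).
    apply: sublevel_bounded_coercive => c; near=> x.
    have Ixc : c / delta < I x by near: x; exact: coercive_gt.
    have Jx : delta * I x <= I x - lambda * psi x by near: x; exact: deltaP.
    by rewrite E0; move: Ixc; rewrite ltr_pdivrMr//; lra.
  apply: (sublevel_bounded_shift _ _ (E 0) _ 0) => // x; rewrite addr0 lerDl.
  by rewrite mulr_ge0 ?invr_ge0 ?sqr_ge0.
have F_lsc : weak_lsc (penalized dot I psi phi lambda).
  exact: penalized_weak_lsc.
have [x0 x0min] := weak_lsc_min _ X_reflexive F_lsc F_bounded.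
have [x00|x0n0] := eqVneq x0 0; last first.
  by left; exists x0 => //; apply: penalized_min_critical.
right=> S S_convex ST S_dense; apply: contrapT => no_y.
have E_PS y : T y -> palais_smale (E y).
  by move=> /E_bounded; apply: energy_palais_smale.
have E_C1 y : C1 (E y) by apply: energy_C1.
pose g x y := E y x - 2^-1 * `|y| ^+ 2.
have g_min y x : global_min (g^~ y) x -> global_min (E y) x.
  by move=> xmin z; have := xmin z; rewrite /g lerD2r.
have g_unique y x x' : S y -> global_min (g^~ y) x -> global_min (g^~ y) x' ->
    x = x'.
  move=> Sy /g_min xmin /g_min x'min; apply/eqP/negPn/negP => xx'.
  have [x3 [x3x x3x' x3c]] :=
    third_critical_point (E y) (E_C1 y) (E_PS y (ST y Sy)) x x' xx' xmin x'min.
  apply: no_y; exists y => //; exists x, x', x3; split=> //.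
    by rewrite /= !inE negb_or xx' eq_sym x3x eq_sym x3x'.
  have crit z : frechet (E y) z = 0 ->
      frechet I z = partial_x dot phi z y + lambda *: frechet psi z.
    exact: energy_critical.
  move=> z; rewrite !inE => /or3P zP; apply: crit; case: zP => /eqP ->.
  - exact: (global_min_critical _ (E_C1 y) _ xmin).
  - exact: (global_min_critical _ (E_C1 y) _ x'min).
  - exact: x3c.
have [x1 [psix1 Ix1]] : exists x1, 0 < psi x1 /\ E 0 x1 < 0.
  move: theta_star_lt => /ereal_inf_lt[_ [x1 /= psix1 <-]].
  rewrite lte_fin ltr_pdivrMr// => Ix1; exists x1; split=> //.
  by rewrite E0 subr_lt0.
pose a := - E 0 x1; have a0 : 0 < a by rewrite oppr_gt0.
(* [eta] is chosen so that [b * eta <= a / 2]; the added one covers [b = 0]. *)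
pose b := `|phi x1|; pose eta := a / (2 * (b + 1)).
have b0 : 0 <= b by exact: normr_ge0.
have b1 : 0 < b + 1 by rewrite ltr_wpDl.
have eta0 : 0 < eta by rewrite divr_gt0// mulr_gt0.
(* For [|y| >= eta] the point [0] gives at most [- eta^2 / 2]; for smaller [y] the point [x1] gives
   at most [- a + b * eta], hence at most [- a / 2]. *)
pose r := - Num.min (2^-1 * eta ^+ 2) (a / 2).
have eta2 : 0 < eta ^+ 2 by exact: exprn_gt0.
have r0 : r < 0.
  rewrite /r oppr_lt0 lt_min; apply/andP; split; last exact: divr_gt0.
  by apply: mulr_gt0 => //; rewrite invr_gt0.
have [|y Sy|y Sy|x|x y y' t|||x xr] := @minimax R Y X S g r X_reflexive.
- exact: convex_segment_closed.
- apply: (weak_lsc_shift _ _ (E y) _ (- (2^-1 * `|y| ^+ 2))) => //.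
  exact: energy_weak_lsc.
- exact: (sublevel_bounded_shift _ _ (E y) _ (- (2^-1 * `|y| ^+ 2))
    (E_bounded y (ST y Sy))).
- exact: energy_continuous.
- exact: energy_concave.
- exact: g_unique.
- move=> y Sy; have [ye|ye] := lerP eta `|y|.
    exists 0; rewrite /g /E /energy I0 psi0 phi0 dot0l mulr0 !subr0 sub0r.
    rewrite lerN2 ge_min ler_wpM2l ?invr_ge0//.
    by rewrite lerXn2r ?nnegrE// ltW.
  exists x1.
  have Ey : E y x1 = - a - dot (phi x1) y.
    by rewrite /a opprK E0 /E /energy addrAC.
  have etaE : eta * (b + 1) = a / 2 by rewrite /eta; field; rewrite gt_eqF.
  have dot_ge : - dot (phi x1) y <= b * eta.
    apply: le_trans (ler_norm _) _; rewrite normrN.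
    apply: le_trans (dot_le _ Y_hilbert _ _) _.
    by rewrite ler_wpM2l//; exact: ltW.
  have ra : - (a / 2) <= r by rewrite lerN2 ge_min lexx orbT.
  apply: le_trans ra; rewrite /g Ey; have := sqr_ge0 `|y|.
  move: (`|y| ^+ 2) => y2; move: dot_ge etaE; rewrite mulrDr mulr1; lra.
have Fx0 z : 0 <= penalized dot I psi phi lambda z.
  apply: le_trans (x0min z).
  rewrite x00 /penalized -/(E 0 0) E0 I0 psi0 phi0 normr0 expr0n !mulr0.
  by rewrite subr0 addr0.
have gF : g x (- phi x) = penalized dot I psi phi lambda x.
  by rewrite /g normrN -penalizedE.
(* The minimax point has [g x y <= r < 0] on [S], yet [g x] is nonnegative at [- phi x]; by
   continuity it exceeds [r] on a nonempty open set, which the dense [S] must meet. *)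
have gr_open : open [set y | r < g x y].
  apply: (@open_comp _ _ (g x) [set s | r < s]); last exact: open_gt.
  by move=> y _; exact: energy_continuous.
have gr_neq0 : [set y | r < g x y] !=set0.
  by exists (- phi x); rewrite /= gF; exact: lt_le_trans (Fx0 x).
have [y [/= yr Sy]] := S_dense _ gr_neq0 gr_open.
by have := xr y Sy; rewrite leNgt yr.
Unshelve. all: by end_near. Qed.
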